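(* Let $\tilde w\in\tilde W$ and let $\underline\theta=(\theta_1<\dots<\theta_r)$ be an admissible sequence of elements of $\Gamma_{\tilde w}$, with associated irredundant sequence $r(\underline\theta)=(\vartheta_1,\dots,\vartheta_k)$, where $\vartheta_j=\theta_{i_j}$. Suppose that the fundamental chamber $C$ is in good position with respect to $(\tilde w,\underline\theta)$. Let $d\in\mathbb N$ be such that $d\vartheta_j/2\pi\in\mathbb Z$ for all $j$, and for $0\le j\le k-1$ let $w_j$ be the maximal element of $W_{i_j}$. Then, in $\tilde B^+$, $$\underline{\tilde w}^{\,d}=\sigma\,\underline{w_0}^{\,d\vartheta_1/\pi}\,\underline{w_1}^{\,d(\vartheta_2-\vartheta_1)/\pi}\cdots\underline{w_{k-1}}^{\,d(\vartheta_k-\vartheta_{k-1})/\pi}$$ for some $\sigma\in\langle\delta\rangle$. If moreover $d$ is even, then $$\underline{\tilde w}^{\,d/2}=\sigma'\,\underline{w_0}^{\,d\vartheta_1/2\pi}\,\underline{w_1}^{\,d(\vartheta_2-\vartheta_1)/2\pi}\cdots\underline{w_{k-1}}^{\,d(\vartheta_k-\vartheta_{k-1})/2\pi}$$ for some $\sigma'\in\langle\delta\rangle$.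
   Context: $(W,S)$ is a finite Coxeter group with simple reflections $s_i$ ($i\in S$) and length function $\ell$; $\delta:W\to W$ is a group automorphism permuting the simple reflections; $\tilde W=\langle\delta\rangle\ltimes W$, with $\ell(\delta^k w)=\ell(w)$ for $k\in\mathbb Z$, $w\in W$. $V$ is a finite-dimensional real inner product space with an injective homomorphism $\tilde W\to GL(V)$ preserving the inner product, such that each $s_i$ acts as a reflection. $\mathfrak H$ is the set of hyperplanes $H\subset V$ whose orthogonal reflection $s_H$ lies in $W$. A Weyl chamber is a connected component of $V-\bigcup_{H\in\mathfrak H}H$. The fundamental chamber $C$ is the Weyl chamber whose walls are the reflecting hyperplanes of the $s_i$, $i\in S$, and $\delta(C)=C$. For a convex subset $K\subset V$, $\mathfrak H_K=\{H\in\mathfrak H: K\subset H\}$, $W_K$ is the subgroup of $W$ generated by the $s_H$, $H\in\mathfrak H_K$, and a point $x\in K$ is a regular point of $K$ if every $H\in\mathfrak H$ containing $x$ contains $K$. $\Gamma_{\tilde w}$ is the set of $\theta\in[0,\pi]$ such that $e^{\sqrt{-1}\,\theta}$ is an eigenvalue of $\tilde w$ on $V\otimes_{\mathbb R}\mathbb C$, and $V^\theta_{\tilde w}=\{v\in V:\tilde w(v)+\tilde w^{-1}(v)=2\cos\theta\, v\}$. Given a sequence $\underline\theta=(\theta_1,\dots,\theta_r)$ in $\Gamma_{\tilde w}$ with $\theta_1<\dots<\theta_r$, set $F_i=\sum_{j=1}^i V^{\theta_j}_{\tilde w}$ for $0\le i\le r$ (so $F_0=0$) and $W_i=W_{F_i}$.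 The sequence is admissible if $F_r$ contains a regular point of $V$; then $W=W_0\supset W_1\supset\cdots\supset W_r=\{1\}$. There are unique $0=i_0<i_1<\dots<i_k\le r$ such that $W_{i_j}=W_{i_j+1}=\dots=W_{i_{j+1}-1}\ne W_{i_{j+1}}$ for $0\le j<k$, and $W_{i_k}=\{1\}$; the irredundant sequence associated to $\underline\theta$ is $r(\underline\theta)=(\theta_{i_1},\dots,\theta_{i_k})$. For a Weyl chamber $A$ let $C_i$ be the connected component of $V-\bigcup_{H\in\mathfrak H_{F_i}}H$ containing $A$. $A$ is in good position with respect to $(\tilde w,\underline\theta)$ if for every $0\le i<r$ the closure $\overline{C_i}$ contains a regular point of $F_{i+1}$. If $C$ is in good position, then each $W_i$ is a standard parabolic subgroup of $W$, and its maximal element is its longest element. $B^+$ is the braid monoid associated with $(W,S)$, and $j:W\to B^+$, $w\mapsto\underline w$, is the canonical injection identifying the generators, with $\underline{w_1w_2}=\underline{w_1}\,\underline{w_2}$ whenever $\ell(w_1w_2)=\ell(w_1)+\ell(w_2)$. $\delta$ induces an automorphism of $B^+$; $\tilde B^+=\langle\delta\rangle\ltimes B^+$, and $j$ extends to $\tilde W\to\tilde B^+$ by $\underline{\delta^k w}=\delta^k\underline w$. *)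

(* Defs.v *)
From HB Require Import structures.
From mathcomp Require Import all_boot all_order all_algebra all_fingroup.
From mathcomp Require Import all_classical all_reals all_analysis.
From mathcomp Require Import complex.

Set Implicit Arguments.
Unset Strict Implicit.
Unset Printing Implicit Defensive.

Import Order.TTheory GRing.Theory Num.Theory.
Import numFieldNormedType.Exports.

Local Open Scope quotient_scope.
Local Open Scope classical_set_scope.
Local Open Scope ring_scope.

Notation gen S := {x | x \in S}.

Section Coxeter.
Context {gT : finGroupType}.
Implicit Types (W : {group gT}) (S : {set gT}).

(* W is presented by the generators S and the relations (s t)^m(s,t) = 1,
   where m(s,t) is the order of s t (so m(s,s) = 1). *)
Definition coxeter_system W S : Prop :=
  [/\ <<S>>%g = W :> {set gT},
      (forall s, s \in S -> #[s]%g = 2%N)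
    & forall (H : groupType) (f : gT -> H),
        (forall s t, s \in S -> t \in S ->
           ((f s * f t) ^+ #[s * t] = 1)%g) ->
        exists g : gT -> H,
          {in W &, {morph g : x y / (x * y)%g}} /\ {in S, g =1 f}].

Definition eval_word S (u : seq (gen S)) : gT := (\prod_(s <- u) val s)%g.

Definition expressible S (w : gT) (n : nat) : bool :=
  [exists u : n.-tuple (gen S), eval_word u == w].

(* Junk value 0 outside of the subgroup generated by S. *)
Definition cox_length S (w : gT) : nat :=
  if pselect (exists n, expressible S w n) is left ex then ex_minn ex else 0%N.

Definition reduced_word S (w : gT) : seq (gen S) :=
  if [pick u : (cox_length S w).-tuple (gen S) | eval_word u == w] is Some u
  then tval u else [::].

Definition longest_elt S (G : {set gT}) : gT :=
  [arg max_(u > 1%g in G) cox_length S u].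

(* The word s t s ... of length n. *)
Definition alt_word S (n : nat) (s t : gen S) : seq (gen S) :=
  mkseq (fun i => if odd i then t else s) n.

Inductive braid_cong S : seq (gen S) -> seq (gen S) -> Prop :=
| BraidRel u v (s t : gen S) (m := #[val s * val t]%g) :
    braid_cong (u ++ alt_word m s t ++ v) (u ++ alt_word m t s ++ v)
| BraidRefl u : braid_cong u u
| BraidSym u v : braid_cong u v -> braid_cong v u
| BraidTrans u v w : braid_cong u v -> braid_cong v w -> braid_cong u w.

Definition braid_congb S (u v : seq (gen S)) : bool := `[< braid_cong u v >].

Lemma braid_congb_refl S : reflexive (@braid_congb S).
Proof. by move=> u; apply/asboolP; apply: BraidRefl. Qed.

Lemma braid_congb_sym S : symmetric (@braid_congb S).
Proof. by move=> u v; apply/asboolP/asboolP; apply: BraidSym. Qed.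

Lemma braid_congb_trans S : transitive (@braid_congb S).
Proof.
move=> v u w /asboolP uv /asboolP vw; apply/asboolP; exact: BraidTrans uv vw.
Qed.

Canonical braid_equiv S := EquivRel (@braid_congb S)
  (@braid_congb_refl S) (@braid_congb_sym S) (@braid_congb_trans S).

Definition braid_monoid S : Type := {eq_quot braid_equiv S}.

End Coxeter.

HB.instance Definition _ (gT : finGroupType) (S : {set gT}) :=
  Choice.copy (braid_monoid S) {eq_quot braid_equiv S}.

Section BraidMonoid.
Context {gT : finGroupType} {S : {set gT}}.
Implicit Types (u v : seq (gen S)) (a b c : braid_monoid S).

Definition braid_class u : braid_monoid S := \pi_{eq_quot braid_equiv S} u.
Definition braid_repr b : seq (gen S) := @generic_quotient.repr _ {eq_quot braid_equiv S} b.

Lemma braid_reprK : cancel braid_repr braid_class.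
Proof. by move=> b; rewrite /braid_class /braid_repr generic_quotient.reprK. Qed.

Lemma braid_classP u v : braid_class u = braid_class v <-> braid_cong u v.
Proof.
rewrite /braid_class; split => [/eqmodP/asboolP//|uv].
by apply/eqmodP/asboolP.
Qed.

Lemma braid_repr_cong u : braid_cong (braid_repr (braid_class u)) u.
Proof. by apply/braid_classP; rewrite braid_reprK. Qed.

Lemma braid_cong_cat x y z t :
  @braid_cong gT S x y -> braid_cong z t -> braid_cong (x ++ z) (y ++ t).
Proof.
move=> xy zt; apply: (@BraidTrans _ _ _ (y ++ z)).
  elim: xy => {x y} [u v s s' m|u|u v _ uv|u v w _ uv _ vw].
  - by rewrite -!catA; apply: BraidRel.
  - exact: BraidRefl.
  - exact: BraidSym.
  - exact: BraidTrans uv vw.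
elim: zt => {z t} [u v s s' m|u|u v _ uv|u v w _ uv _ vw].
- by rewrite !(catA y u); apply: BraidRel.
- exact: BraidRefl.
- exact: BraidSym.
- exact: BraidTrans uv vw.
Qed.

Definition braid_mul a b : braid_monoid S :=
  braid_class (braid_repr a ++ braid_repr b).

Definition braid_one : braid_monoid S := braid_class [::].

Lemma braid_mulE u v :
  braid_mul (braid_class u) (braid_class v) = braid_class (u ++ v).
Proof. by apply/braid_classP; apply: braid_cong_cat; apply: braid_repr_cong. Qed.

Lemma braid_mulA : associative braid_mul.
Proof.
move=> a b c; rewrite -[a]braid_reprK -[b]braid_reprK -[c]braid_reprK.
by rewrite !braid_mulE catA.
Qed.

Lemma braid_mul1 : left_id braid_one braid_mul.
Proof. by move=> a; rewrite -[a]braid_reprK braid_mulE. Qed.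

Lemma braid_mulr1 : right_id braid_one braid_mul.
Proof. by move=> a; rewrite -[a]braid_reprK braid_mulE cats0. Qed.

End BraidMonoid.

HB.instance Definition _ (gT : finGroupType) (S : {set gT}) :=
  isMonoid.Build (braid_monoid S) braid_mulA braid_mul1 braid_mulr1.

(* By Matsumoto's theorem the choice of the reduced word is irrelevant. *)
Definition braid_lift (gT : finGroupType) (S : {set gT}) (w : gT) :
  braid_monoid S := braid_class (reduced_word S w).

(* The automorphism delta of the Coxeter group is realized as conjugation
   w |-> delta w delta^-1 by an element of an ambient group.  The pair (a, b) stands for the product
   a b, and (a b) (a' b') = (a a') (a'^-1 b a' b'), so the conjugation action
   needed is b |-> a'^-1 b a' = b ^ a'. *)
Section TwistedBraid.
Context {gT : finGroupType} {S : {set gT}} {delta : gT}.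
Context (nS : delta \in 'N(S)%g).
Local Notation D := [subg <[delta]> ].

Lemma gen_conj_subproof (a : D) (s : gen S) : (val s ^ sgval a)%g \in S.
Proof.
have sDN : (<[delta]> \subset 'N(S))%g by rewrite cycle_subG.
have /(fintype.subsetP sDN) := subgP a.
by move=> aN; rewrite memJ_norm //; case: s.
Qed.

Definition gen_conj (a : D) (s : gen S) : gen S :=
  exist _ (val s ^ sgval a)%g (gen_conj_subproof a s).

Definition braid_conj (a : D) (b : braid_monoid S) : braid_monoid S :=
  braid_class [seq gen_conj a s | s <- braid_repr b].

Lemma map_alt_word a n s t : [seq gen_conj a x | x <- alt_word n s t] =
  alt_word n (gen_conj a s) (gen_conj a t).
Proof.
by rewrite /alt_word /mkseq -map_comp; apply: eq_map => i /=; case: odd.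
Qed.

Lemma braid_conjE a u :
  braid_conj a (braid_class u) = braid_class [seq gen_conj a s | s <- u].
Proof.
apply/braid_classP; move: (braid_repr_cong u); move: (braid_repr _) => u'.
elim=> {u u'} [u v s t m|u|u v _ uv|u v w _ uv _ vw].
- have := BraidRel [seq gen_conj a x | x <- u] [seq gen_conj a x | x <- v]
    (gen_conj a s) (gen_conj a t).
  by rewrite !map_cat !map_alt_word /= -conjMg orderJ.
- exact: BraidRefl.
- exact: BraidSym.
- exact: BraidTrans uv vw.
Qed.

Lemma braid_conj1 b : braid_conj 1%g b = b.
Proof.
rewrite -[b]braid_reprK braid_conjE; congr braid_class.
by rewrite -[RHS]map_id; apply: eq_map => s; apply: val_inj; rewrite /= conjg1.
Qed.

Lemma braid_conjM a a' b :
  braid_conj (a * a')%g b = braid_conj a' (braid_conj a b).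
Proof.
rewrite -[b]braid_reprK !braid_conjE -map_comp; congr braid_class.
by apply: eq_map => s; apply: val_inj; rewrite /= conjgM.
Qed.

Lemma braid_conj_one a : braid_conj a 1%g = 1%g.
Proof. by rewrite (braid_conjE a [::]). Qed.

Lemma braid_conj_mul a b c :
  braid_conj a (b * c)%g = (braid_conj a b * braid_conj a c)%g.
Proof.
rewrite -[b]braid_reprK -[c]braid_reprK [X in braid_conj a X]braid_mulE.
by rewrite !braid_conjE map_cat -braid_mulE.
Qed.

Definition tbraid_of (_ : delta \in 'N(S)%g) : Type := (D * braid_monoid S)%type.
Local Notation tbraid := (tbraid_of nS).
HB.instance Definition _ := Choice.copy tbraid (D * braid_monoid S)%type.

Definition tbraid_mul (x y : tbraid) : tbraid :=
  ((x.1 * y.1)%g, (braid_conj y.1 x.2 * y.2)%g).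

Definition tbraid_one : tbraid := (1%g, 1%g).

Lemma tbraid_mulA : associative tbraid_mul.
Proof.
move=> [a b] [a' b'] [a'' b'']; rewrite /tbraid_mul /=.
by rewrite mulgA braid_conjM braid_conj_mul mulgA.
Qed.

Lemma tbraid_mul1 : left_id tbraid_one tbraid_mul.
Proof.
by move=> [a b]; rewrite /tbraid_mul /= mul1g braid_conj_one mul1g.
Qed.

Lemma tbraid_mulr1 : right_id tbraid_one tbraid_mul.
Proof.
by move=> [a b]; rewrite /tbraid_mul /= !mulg1 braid_conj1.
Qed.

HB.instance Definition _ :=
  isMonoid.Build tbraid tbraid_mulA tbraid_mul1 tbraid_mulr1.

Definition tbraid_delta (a : D) : tbraid := (a, 1%g).

(* x = delta^k w is sent to delta^k (braid_lift w); divgr and remgr give the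
   two factors delta^k and w when the ambient group is <delta> W. *)
Definition tbraid_lift (W : {group gT}) (x : gT) : tbraid :=
  (subg <[delta]> (divgr <[delta]> W x),
   braid_lift S (remgr <[delta]> W x))%g.

End TwistedBraid.

#[short(type="normedVectType")]
HB.structure Definition NormedVect (R : realType) :=
  {V of Vector R V & NormedModule R V}.

Definition inner_norm (R : realType) (V : normedVectType R)
  (ip : {dot V for idfun}) : Prop :=
  forall v : V, `|v| = Num.sqrt (ip v v).

Section Geometry.
Context {R : realType} {V : normedVectType R} (ip : {dot V for idfun}).
Implicit Types (H : {vspace V}) (f : 'End(V)) (K A D U : set V).

Definition orth_refl H f : Prop :=
  [/\ (\dim H).+1 = \dim {:V}, {in H, forall v, f v = v}
    & forall v, {in H, forall u, ip u v = 0} -> f v = - v].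

Context {gT : finGroupType} (W : {group gT}) (rho : gT -> 'End(V)).

Definition orth_rep : Prop :=
  [/\ rho 1%g = \1%VF, (forall x y, rho (x * y)%g = (rho x \o rho y)%VF),
      injective rho & forall x u v, ip (rho x u) (rho x v) = ip u v].

Definition hyps : set {vspace V} :=
  [set H | exists2 x, x \in W & orth_refl H (rho x)].

Definition hyps_of K : set {vspace V} := [set H | hyps H /\ K `<=` [set` H]].

Definition refl_subgroup K : {set gT} :=
  (<<[set x in W | `[< exists2 H, hyps_of K H & orth_refl H (rho x) >]]>>)%g.

Definition regular_point K (v : V) : Prop :=
  K v /\ forall H, hyps H -> v \in H -> K `<=` [set` H].

Definition hyps_compl (HH : set {vspace V}) : set V :=
  ~` \bigcup_(H in HH) [set` H].

Definition is_component U D : Prop :=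
  exists2 v, U v & D = connected_component U v.

Definition weyl_chamber A : Prop := is_component (hyps_compl hyps) A.

(* H is a wall of A when A has a face whose support is H. *)
Definition wall A H : Prop :=
  hyps H /\ exists2 v, closure A v & regular_point [set` H] v.

Definition fundamental_chamber (S : {set gT}) A : Prop :=
  weyl_chamber A /\
  forall H, wall A H <-> exists2 s, s \in S & orth_refl H (rho s).

(* eigenvalue is taken on the matrix over R[i] of the complexified map. *)
Definition Gamma (x : gT) : set R :=
  [set theta : R | 0 <= theta <= pi /\
     eigenvalue (map_mx (real_complex R)
                   (passmx.mxof (vbasis {:V}) (vbasis {:V}) (rho x)))
                (cos theta +i* sin theta)%C].

Definition Vtheta (x : gT) (theta : R) : {vspace V} :=
  lker (rho x + rho x^-1%g - (2 * cos theta) *: \1)%VF.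

(* theta_1, ..., theta_r are theta`_0, ..., theta`_(r - 1). *)
Definition Fsum (x : gT) (theta : seq R) (i : nat) : {vspace V} :=
  (\sum_(j < i) Vtheta x theta`_j)%VS.

Definition Wsub (x : gT) (theta : seq R) (i : nat) : {set gT} :=
  refl_subgroup [set` Fsum x theta i].

Definition admissible (x : gT) (theta : seq R) : Prop :=
  [/\ sorted <%R theta, {in theta, forall t, Gamma x t}
    & exists2 v, v \in Fsum x theta (size theta) & regular_point setT v].

Definition good_position (x : gT) (theta : seq R) A : Prop :=
  forall i, (i < size theta)%N ->
    exists D, [/\ is_component (hyps_compl (hyps_of [set` Fsum x theta i])) D,
      A `<=` D
    & exists2 v, closure D v & regular_point [set` Fsum x theta i.+1] v].

End Geometry.

(* i 0 < ... < i k are the indices i_0, ..., i_k of the irredundant sequence of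
   a chain Wi 0, ..., Wi r. *)
Definition irredundant_indices (gT : finGroupType) (Wi : nat -> {set gT})
    (r k : nat) (i : nat -> nat) : Prop :=
  [/\ i 0%N = 0%N, (forall j, (j < k)%N -> (i j < i j.+1)%N), (i k <= r)%N,
      (forall j, (j < k)%N ->
         (forall m, (i j <= m < i j.+1)%N -> Wi m = Wi (i j)) /\
         Wi (i j.+1).-1 <> Wi (i j.+1))
    & Wi (i k) = 1%g].

(* The terms vartheta_1, ..., vartheta_k, extended by vartheta_0 = 0. *)
Definition vartheta (R : realType) (theta : seq R) (i : nat -> nat)
    (j : nat) : R :=
  if j is 0 then 0 else theta`_(i j).-1.

(* Truncation is used only at real numbers that are natural numbers. *)
Definition twist_exponent (R : realType) (theta : seq R) (i : nat -> nat)
    (d : nat) (c : R) (j : nat) : nat :=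
  Num.truncn (d%:R * (vartheta theta i j.+1 - vartheta theta i j) / c).

(* Main.v *)
(* Let N(x) be the set of reflections whose hyperplanes separate C from xC.
   The lift to the braid monoid is multiplicative on x, y when the galleries
   C -> xC -> xyC cross no hyperplane twice; this is all the braid theory
   needed, and it rests on Matsumoto's theorem.  For each i let x_i be the
   element of minimal length in w W_i, so that x_r = w and x_0 is a power of
   delta.  It suffices to show, when W_i <> W_{i+1} and n theta_{i+1} = m pi,
     lift(x_{i+1})^n omega_{i+1}^m = lift(x_i)^n omega_i^m,
   where omega_i is the longest element of W_i.  Take v in F_{i+1} as provided
   by good position, and a reflection in W_i but not in W_{i+1}, with root
   alpha.  The sign of <alpha, x_{i+1}^j v> tells whether its hyperplane
   separates the chambers at time j, and this number is
   a cos(j theta) + b sin(j theta) with a > 0: over each half turn every such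
   hyperplane is crossed exactly once.  The gallery can therefore be rerouted
   through the chambers at angles 0, pi, 2 pi, ..., where it becomes the
   alternating product of z = omega_{i+1} omega_i and z^-1, and these factors
   combine with omega_{i+1}^m to omega_i^m. *)
From HB Require Import structures.
Require Import Defs.
From mathcomp Require Import all_boot all_order all_algebra all_fingroup.
From mathcomp Require Import cyclic.
From mathcomp Require Import all_classical all_reals all_analysis.
From mathcomp Require Import ring lra.

Set Implicit Arguments.
Unset Strict Implicit.
Unset Printing Implicit Defensive.

Import Order.TTheory GRing.Theory Num.Theory.
Import numFieldNormedType.Exports.

Local Open Scope ring_scope.

(** * Words and reduced expressions in the Coxeter group *)

(* [N x] plays the role of the set of reflections whose hyperplanes separate
   the chambers C and xC. *)
Record inversion_system (gT : finGroupType) (W : {group gT}) (S : {set gT})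
    (N : gT -> {set gT}) : Prop := InversionSystem {
  inv_gen : <<S>>%g = W;
  inv_order : forall s, s \in S -> #[s]%g = 2%N;
  inv_simple : forall s, s \in S -> N s = [set s]%SET;
  inv_mul : forall x y t,
    (t \in N (x * y)%g) = (t \in N x) (+) ((t ^ x)%g \in N y)
}.

Lemma conjg_self (gT : finGroupType) (x : gT) : (x ^ x = x)%g.
Proof. by rewrite conjgE mulKg. Qed.

Lemma expg_mulSC (gT : finGroupType) (x y : gT) n :
  ((x * y) ^+ n.+1 = x * (y * x) ^+ n * y)%g.
Proof.
elim: n => [|n IH]; first by rewrite mulg1.
by rewrite expgS IH [in RHS]expgS !mulgA.
Qed.

Section Words.
Context (gT : finGroupType) (W : {group gT}) (S : {set gT}).
Context (N : gT -> {set gT}) (sysN : inversion_system W S N).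
Implicit Types (s : gen S) (u v : seq (gen S)) (t x y : gT).
Local Open Scope group_scope.

Lemma eval_cons s u : eval_word (s :: u) = val s * eval_word u.
Proof. by rewrite /eval_word big_cons. Qed.

Lemma eval_cat u v : eval_word (u ++ v) = eval_word u * eval_word v.
Proof. by rewrite /eval_word big_cat. Qed.

Lemma simple_mulK s x : val s * (val s * x) = x.
Proof.
rewrite mulgA; have <- : (val s) ^+ 2 = val s * val s by [].
by rewrite -(inv_order sysN (valP s)) expg_order mul1g.
Qed.

Lemma simple_inv s : (val s)^-1 = val s.
Proof. by apply/eqP; rewrite eq_invg_mul -[X in _ * X]mulg1 simple_mulK. Qed.

Lemma inv1 : N 1 = finset.set0.
Proof.
by apply/setP => t; have := inv_mul sysN 1 1 t; rewrite mulg1 conjg1 addbb inE.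
Qed.

Lemma inv_invg x t : (t ^ x \in N x^-1) = (t \in N x).
Proof.
have := inv_mul sysN x x^-1 t; rewrite mulgV inv1 inE.
by case: (t \in N x); case: (t ^ x \in _).
Qed.

(** A hyperplane separates [xC] from [yC] exactly when it lies in one of [N x] and [N y];
    translation by [x^-1] moves this pair to [C] and [x^-1 yC]. *)
Lemma inv_quot x y t : (t ^ x \in N (x^-1 * y)) = (t \in N x) (+) (t \in N y).
Proof. by rewrite (inv_mul sysN) inv_invg -conjgM mulgV conjg1. Qed.

Lemma inv_simple_mul s x t :
  (t \in N (val s * x)) = (t == val s) (+) (t ^ val s \in N x).
Proof. by rewrite (inv_mul sysN) (inv_simple sysN (valP s)) inE. Qed.

Lemma card_inv_mul x y : (forall t, t \in N x -> t ^ x \notin N y) ->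
  #|N (x * y)| = (#|N x| + #|N y|)%N.
Proof.
move=> disj; pose Ny := [set t | t ^ x \in N y].
have -> : #|N y| = #|Ny|.
  rewrite -[RHS](cardJg _ x); apply: eq_card => t.
  by rewrite mem_conjg inE conjgKV.
rewrite -cardsUI (_ : N x :&: Ny = finset.set0) ?cards0 ?addn0.
  apply: eq_card => t; rewrite (inv_mul sysN) !inE.
  by have := disj t; case: (t \in N x) => // /(_ isT) /negPf ->.
apply/setP => t; rewrite !inE; apply/negP => /andP[tx].
exact/negP/disj.
Qed.

Lemma card_inv_simple s x :
  #|N (val s * x)| = (if val s \in N x then #|N x|.-1 else #|N x|.+1)%N.
Proof.
case: ifPn => sNx; last first.
  rewrite card_inv_mul ?(inv_simple sysN (valP s)) ?cards1 ?add1n // => t.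
  by rewrite inE => /eqP ->; rewrite conjg_self.
have := @card_inv_mul (val s) (val s * x); rewrite simple_mulK.
rewrite (inv_simple sysN (valP s)) cards1 => -> // t.
by rewrite inE => /eqP ->; rewrite conjg_self inv_simple_mul eqxx conjg_self sNx.
Qed.

(** The gallery spelled by [u] crosses the hyperplane of [t] at some letter, and deleting that
    letter reflects what follows. In the induction [t] is either the first letter or is conjugated
    past it. *)
Lemma exchange u t : t \in N (eval_word u) -> exists u1 s u2,
  u = u1 ++ s :: u2 /\ t * eval_word u = eval_word (u1 ++ u2).
Proof.
elim: u t => [|s u IH] t; first by rewrite /eval_word big_nil inv1 inE.
rewrite eval_cons inv_simple_mul; case: eqVneq => [-> _|_ /= /IH].
  by exists [::], s, u; rewrite simple_mulK.
move=> [u1 [s' [u2 [-> E]]]]; exists (s :: u1), s', u2; split=> //.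
by rewrite /= eval_cons -E conjgE !mulgA simple_inv -!mulgA simple_mulK.
Qed.

Lemma card_inv_word u : (#|N (eval_word u)| <= size u)%N.
Proof.
elim: u => [|s u IH]; first by rewrite /eval_word big_nil inv1 cards0.
rewrite eval_cons card_inv_simple /=; case: ifP => _ //.
by rewrite (leq_trans (leq_pred _)) // ltnW.
Qed.

(** Length is measured by inversions, which can be followed letter by letter; [cox_lengthE]
    identifies this count with [cox_length] on [W]. *)
Definition reduced u := size u == #|N (eval_word u)|.

Lemma reduced_cons s u : reduced (s :: u) ->
  reduced u /\ val s \in N (eval_word (s :: u)).
Proof.
rewrite /reduced eval_cons card_inv_simple inv_simple_mul eqxx conjg_self.
have := card_inv_word u; case: ifP => sN le_u /= /eqP E; last first.
  by split=> //; apply/eqP; case: E.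
have : (0 < #|N (eval_word u)|)%N by rewrite card_gt0; apply/set0Pn; exists (val s).
move=> /prednK E0; move: le_u.
by rewrite -E0 -E ltnNge leqnSn.
Qed.

Lemma reduced_exists x : x \in W -> exists2 u, eval_word u = x & reduced u.
Proof.
rewrite -(inv_gen sysN) => /gen_prodgP[n [c cS ->]].
have [u <-] : exists u, eval_word u = \prod_(i < n) c i.
  pose g i : gen S := exist _ (c i) (cS i).
  exists [seq g i | i <- index_enum 'I_n].
  by rewrite /eval_word big_map.
elim: u => [|s u [u' E red]].
  by exists [::] => //; rewrite /reduced /eval_word big_nil inv1 cards0.
have [sN|sN] := boolP (val s \in N (eval_word u)); last first.
  exists (s :: u'); first by rewrite !eval_cons E.
  by rewrite /reduced eval_cons E card_inv_simple (negPf sN) -E -(eqP red).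
move: (sN); rewrite -E => /exchange[u1 [s' [u2 [Eu' Es]]]].
exists (u1 ++ u2); first by rewrite -Es eval_cons E.
rewrite /reduced -Es E card_inv_simple sN -E -(eqP red) Eu' !size_cat /=.
by rewrite addnS.
Qed.

Lemma card_inv_lt x t : x \in W -> t \in N x -> (#|N (t * x)%g| < #|N x|)%N.
Proof.
move=> /reduced_exists[u <- /eqP red] /exchange[u1 [s [u2 [Eu ->]]]].
rewrite -red Eu (leq_ltn_trans (card_inv_word _)) //.
by rewrite !size_cat /= addnS.
Qed.

(** No hyperplane is left between [xC] and [yC], so [x^-1 * y] has the empty reduced word.
    Membership in [W] excludes nontrivial powers of [delta], which will have no inversions
    either. *)
Lemma inv_inj x y : x^-1 * y \in W -> N x = N y -> x = y.
Proof.
move=> /reduced_exists[u Eu /eqP].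
rewrite Eu => + Nxy; have -> : N (x^-1 * y) = finset.set0.
  by apply/setP => t; rewrite -[t](conjgKV x) inv_quot Nxy addbb inE.
rewrite cards0 => /size0nil E0; move: Eu; rewrite E0 /eval_word big_nil => E.
by apply: (mulgI x^-1); rewrite mulVg.
Qed.

Lemma cox_lengthE x : x \in W -> cox_length S x = #|N x|.
Proof.
move=> xW; have [u Eu /eqP redu] := reduced_exists xW.
have ex_u : expressible S x (size u).
  by apply/existsP; exists (in_tuple u); rewrite Eu.
rewrite /cox_length; case: pselect => [ex|[]]; last by exists (size u).
case: ex_minnP => n /existsP[v /eqP Ev] /(_ _ ex_u) le_n; apply/eqP.
rewrite eqn_leq -{1}Eu -redu le_n -Ev -[X in (_ <= X)%N](size_tuple v).
exact: card_inv_word.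
Qed.

Lemma reduced_wordP x : x \in W ->
  eval_word (reduced_word S x) = x /\ reduced (reduced_word S x).
Proof.
move=> xW; rewrite /reduced_word; case: pickP => [u /eqP Eu|no].
  by split=> //; rewrite /reduced Eu size_tuple cox_lengthE.
have [u Eu /eqP redu] := reduced_exists xW.
have sz : size u == cox_length S x by rewrite cox_lengthE // redu Eu.
by have /eqP[] := no (Tuple sz).
Qed.

Lemma alt_wordS n (s t : gen S) : alt_word n.+1 s t = s :: alt_word n t s.
Proof.
rewrite /alt_word /mkseq /= -[1%N]addn0 iotaDl -map_comp; congr cons.
by apply: eq_map => i /=; case: odd.
Qed.

Lemma inv_alt_word n (s t : gen S) x : x \in N (eval_word (alt_word n s t)) ->
  exists2 i, (i < n)%N & x = (val s * val t) ^+ i * val s.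
Proof.
elim: n s t x => [|n IH] s t x.
  by rewrite /alt_word /= /eval_word big_nil inv1 inE.
rewrite alt_wordS eval_cons inv_simple_mul; case: eqVneq => [->|_ /= /IH].
  by exists 0%N => //; rewrite expg0 mul1g.
case=> i lt_i E; exists i.+1 => //.
rewrite expg_mulSC -(mulgA (val s)) -E conjgE simple_inv -!mulgA.
by rewrite simple_mulK -[X in _ = _ * (_ * X)]mulg1 simple_mulK mulg1.
Qed.
End Words.

(** * Matsumoto's theorem *)

Section Matsumoto.
Context (gT : finGroupType) (W : {group gT}) (S : {set gT}).
Context (N : gT -> {set gT}) (sysN : inversion_system W S N).
Implicit Types (s t : gen S) (u v : seq (gen S)) (x y : gT).
Local Open Scope group_scope.

(** Otherwise [s = (t s)^i t] with [i < n], that is [(s t)^(i+1) = 1] with an exponent below the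
    order of [s t]. *)
Lemma inv_alt_wordC n s t : (n < #[val s * val t])%N ->
  val s \notin N (eval_word (alt_word n t s)).
Proof.
move=> lt_n; apply/negP => /(inv_alt_word sysN)[i lt_i E].
have /eqP : (val s * val t) ^+ i.+1 = 1.
  by rewrite expg_mulSC -mulgA -E -[X in _ * X]mulg1 (simple_mulK sysN).
rewrite -order_dvdn => /dvdn_leq => /(_ isT).
by rewrite leqNgt (leq_ltn_trans lt_i lt_n).
Qed.

Lemma eval_alt_word_quot n s t :
  eval_word (alt_word n s t) * (eval_word (alt_word n t s))^-1 =
    (val s * val t) ^+ n.
Proof.
elim: n s t => [|n IH] s t; first by rewrite mulgV.
rewrite !alt_wordS !eval_cons invMg (simple_inv sysN) expg_mulSC -IH.
by rewrite !mulgA.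
Qed.

Lemma eval_alt_word s t : eval_word (alt_word #[val s * val t] s t) =
  eval_word (alt_word #[val s * val t] t s).
Proof.
have := eval_alt_word_quot #[val s * val t] s t; rewrite expg_order.
by move/(canRL (mulgKV _)); rewrite mul1g.
Qed.

(** Each step swaps the roles of [s] and [t] and prepends one letter, which the exchange property
    compensates by deleting a letter of the tail. *)
Lemma alt_word_prefix x s t n : x \in W -> val s \in N x -> val t \in N x ->
  (n <= #[val s * val t])%N ->
  exists z, eval_word (alt_word n s t ++ z) = x /\
            size (alt_word n s t ++ z) = #|N x|.
Proof.
move=> xW; elim: n s t => [|n IH] s t sx tx le_n.
  by have [u Eu /eqP redu] := reduced_exists sysN xW; exists u; rewrite -Eu.
have comm_order : #[val t * val s] = #[val s * val t].
  by rewrite -[RHS](orderJ _ (val s)) conjgE !mulgA mulVg mul1g.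
have [|z [Ez size_z]] := IH t s tx sx; first by rewrite comm_order ltnW.
(* [s] is an inversion of [x] but not of the alternating prefix, so the letter to delete lies in
   [z]. *)
have : val s ^ eval_word (alt_word n t s) \in N (eval_word z).
  have := inv_mul sysN (eval_word (alt_word n t s)) (eval_word z) (val s).
  by rewrite -eval_cat Ez sx (negPf (inv_alt_wordC le_n)).
move=> /(exchange sysN)[u1 [s' [u2 [Ez' E]]]]; exists (u1 ++ u2); split.
  rewrite eval_cat -E alt_wordS eval_cons conjgE !mulgA mulgK.
  by rewrite -!mulgA -eval_cat Ez (simple_mulK sysN).
rewrite -size_z Ez' !size_cat !size_mkseq.
by rewrite addSn !addnS.
Qed.

(** Both first letters are left descents, so the element also has reduced words beginning with
    either side of their braid relation. Words with a common first letter are compared by induction,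
    and the braid relation joins the two middle words. If [s = t] then [m = 1] and the same argument
    applies. *)
Theorem matsumoto u v : eval_word u \in W -> reduced N u -> reduced N v ->
  eval_word u = eval_word v -> braid_cong u v.
Proof.
have [n] := ubnP (size u).
elim: n u v => [|n IH] // u v lt_n uW redu redv Euv.
have size_uv : size u = size v by rewrite (eqP redu) Euv -(eqP redv).
case: u v => [|s u] [|t v] // in lt_n uW redu redv Euv size_uv *.
  exact: BraidRefl.
have [redu' su] := reduced_cons sysN redu.
have [redv' tv] := reduced_cons sysN redv.
have SW (r : gen S) : val r \in W by rewrite -(inv_gen sysN); apply: mem_gen; exact: (valP r).
have tail (r : gen S) a b : (size a < n)%N -> eval_word (r :: a) \in W ->
    reduced N (r :: a) -> reduced N (r :: b) ->
    eval_word (r :: a) = eval_word (r :: b) -> braid_cong (r :: a) (r :: b).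
  move=> lt_a aW reda redb Eab; rewrite -(cat1s r a) -(cat1s r b).
  apply: braid_cong_cat; first exact: BraidRefl.
  apply: IH => //; [|exact: (reduced_cons sysN reda).1
    |exact: (reduced_cons sysN redb).1|].
  - by move: aW; rewrite eval_cons groupMl.
  - by move: Eab; rewrite !eval_cons => /mulgI.
rewrite -Euv in tv.
have [z [Ez size_z]] := alt_word_prefix uW su tv (leqnn _).
move: Ez size_z; set m := #[_] => Ez size_z.
have Ez' : eval_word (alt_word m t s ++ z) = eval_word (s :: u).
  by rewrite eval_cat -eval_alt_word -eval_cat.
have m_gt0 : (0 < m)%N := order_gt0 _.
have size_alt a b : size (alt_word m a b) = m by rewrite size_mkseq.
have [redz redz'] : reduced N (alt_word m s t ++ z) /\
                    reduced N (alt_word m t s ++ z).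
  by rewrite /reduced Ez Ez' -size_z !size_cat !size_alt.
have Ealt a b : alt_word m a b = a :: alt_word m.-1 b a.
  by rewrite -alt_wordS prednK.
apply: (@BraidTrans _ _ _ (alt_word m s t ++ z)).
  by move: Ez redz; rewrite Ealt cat_cons => Ez redz; apply: tail.
apply: (@BraidTrans _ _ _ (alt_word m t s ++ z)).
  exact: (BraidRel [::] z s t).
apply: BraidSym; move: Ez' redz'; rewrite Ealt cat_cons Euv => Ez' redz'.
by apply: tail => //; rewrite -?Euv //; case: size_uv => <-.
Qed.

Lemma braid_lift_eval u : eval_word u \in W -> reduced N u ->
  braid_lift S (eval_word u) = braid_class u.
Proof.
move=> uW redu; have [E red] := reduced_wordP sysN uW.
by apply/braid_classP/matsumoto => //; rewrite E.
Qed.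

Lemma braid_liftM x y : x \in W -> y \in W ->
  (forall t : gT, t \in N x -> t ^ x \notin N y) ->
  braid_lift S (x * y) = braid_lift S x * braid_lift S y.
Proof.
move=> xW yW /(card_inv_mul sysN).
have [u Eu /eqP redu] := reduced_exists sysN xW.
have [v Ev /eqP redv] := reduced_exists sysN yW.
rewrite -Eu -Ev in xW yW *; rewrite -redu -redv -eval_cat => size_uv.
rewrite !braid_lift_eval ?[RHS]braid_mulE //; try exact/eqP.
  by rewrite eval_cat groupM.
by rewrite /reduced size_cat -size_uv.
Qed.

Lemma braid_lift1 : braid_lift S (1 : gT) = 1.
Proof.
have E : eval_word (Nil (gen S)) = 1 by rewrite /eval_word big_nil.
by rewrite -E braid_lift_eval ?E // /reduced E (inv1 sysN) cards0.
Qed.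
End Matsumoto.

(** * The lift to the twisted braid monoid *)

Section TwistedLift.
Context (gT : finGroupType) (W : {group gT}) (S : {set gT}) (delta : gT).
Context (nS : delta \in 'N(S)%g) (sdW : (W ><| <[delta]> = [set: gT])%g).
Context (N : gT -> {set gT}) (sysN : inversion_system W S N).
Context (Ndelta : N delta = finset.set0).
Implicit Types (t x y : gT).
Local Notation lift := (tbraid_lift nS W).
Local Open Scope group_scope.

Lemma inv_twist a : a \in <[delta]> -> N a = finset.set0.
Proof.
case/cycleP=> n ->; elim: n => [|n IH]; first exact: inv1 sysN.
by apply/setP => t; rewrite expgS (inv_mul sysN) Ndelta IH !inE.
Qed.

Lemma inv_twist_mul a x t : a \in <[delta]> ->
  (t \in N (a * x)) = (t ^ a \in N x).
Proof. by move=> aD; rewrite (inv_mul sysN) (inv_twist aD) inE. Qed.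

Lemma inv_mul_twist a x : a \in <[delta]> -> N (x * a) = N x.
Proof.
by move=> aD; apply/setP=> t; rewrite (inv_mul sysN) (inv_twist aD) inE addbF.
Qed.

Lemma inv_conj_twist a x : a \in <[delta]> -> N (x ^ a) = N x :^ a.
Proof.
move=> aD; apply/setP=> t; rewrite conjgE inv_twist_mul ?groupV //.
by rewrite inv_mul_twist // mem_conjg.
Qed.

Lemma twist_conjW a x : a \in <[delta]> -> x \in W -> x ^ a \in W.
Proof.
have [/andP[_ nWT] _ _ _ _] := sdprod_context sdW.
by move=> aD xW; rewrite memJ_norm // (fintype.subsetP nWT) ?inE.
Qed.

Lemma twist_factor x : exists a u, [/\ a \in <[delta]>, u \in W & x = a * u].
Proof.
have xDW : x \in <[delta]> * W by rewrite (sdprodWC sdW) inE.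
exists (divgr <[delta]> W x), (remgr <[delta]> W x).
by rewrite mem_divgr ?mem_remgr // -divgr_eq.
Qed.

Lemma card_inv_lt_twist x t : t \in N x -> (#|N (t * x)%g| < #|N x|)%N.
Proof.
have [a [u [aD uW ->]]] := twist_factor x.
rewrite (conjgCV a u) mulgA !(inv_mul_twist _ aD); apply: (card_inv_lt sysN).
by rewrite twist_conjW ?groupV.
Qed.

Lemma lift_factor a u : a \in <[delta]> -> u \in W ->
  lift (a * u) = (subg <[delta]> a, braid_lift S u) :> tbraid_of nS.
Proof.
have [_ _ _ _ ti] := sdprod_context sdW.
have ti' : <[delta]> :&: W = 1 by rewrite finset.setIC.
by move=> aD uW; rewrite /tbraid_lift divgrMid ?remgrMid.
Qed.

Lemma lift_twist a : a \in <[delta]> ->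
  lift a = tbraid_delta nS (subg <[delta]> a).
Proof.
by move=> aD; rewrite -[a in LHS]mulg1 lift_factor // (braid_lift1 sysN).
Qed.

(** A twist permutes the letters and conjugates inversion sets, so it takes reduced words to reduced
    words. *)
Lemma braid_lift_conj (a : [subg <[delta]> ]) u : u \in W ->
  braid_lift S (u ^ sgval a) = braid_conj nS a (braid_lift S u).
Proof.
move=> uW; have aD := subgP a.
have [v Ev redv] := reduced_exists sysN uW.
have Eva : eval_word [seq gen_conj nS a s | s <- v] = u ^ sgval a.
  rewrite -Ev; elim: v {Ev redv} => [|s v IH].
    by rewrite /eval_word !big_nil conj1g.
  by rewrite /= !eval_cons IH conjMg.
have uaW : u ^ sgval a \in W by rewrite twist_conjW.
rewrite -Eva -Ev !(braid_lift_eval sysN) ?Ev ?Eva // ?braid_conjE //.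
by rewrite /reduced Eva size_map inv_conj_twist // cardJg -Ev.
Qed.

(** For [x = a u] and [y = b v] the twist [b] is moved across [u]; the absence of double crossings
    for [x], [y] becomes that for [u ^ b], [v], where lengths in [W] add. *)
Lemma lift_mul x y : (forall t, t \in N x -> t ^ x \notin N y) ->
  lift (x * y) = lift x * lift y.
Proof.
have [a [u [aD uW ->]]] := twist_factor x.
have [b [v [bD vW ->]]] := twist_factor y => disj.
have ubW : u ^ b \in W by rewrite twist_conjW.
have Exy : a * u * (b * v) = (a * b) * (u ^ b * v).
  by rewrite (conjgE u) -!mulgA mulKVg.
rewrite Exy (lift_factor (groupM aD bD) (groupM ubW vW)) !lift_factor //.
rewrite (braid_liftM sysN) //.
  have Eb : sgval (subg <[delta]> b) = b := subgK b bD.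
  apply: (congr2 pair); first by rewrite subgM.
  by rewrite /= -braid_lift_conj // Eb.
move=> t; rewrite inv_conj_twist // mem_conjg.
set r := t ^ b^-1 => ru.
have := disj (r ^ a^-1); rewrite inv_twist_mul // conjgKV => /(_ ru).
by rewrite inv_twist_mul // -[u ^ b]/(b^-1 * (u * b)) !conjgM conjgKV.
Qed.

(* The gallery from xC to zC may pass through yC if no hyperplane separates yC
   from both xC and zC. *)
Lemma lift_mid x y z :
  (forall t, (t \in N x) (+) (t \in N y) -> (t \in N y) = (t \in N z)) ->
  lift (x^-1 * z) = lift (x^-1 * y) * lift (y^-1 * z).
Proof.
move=> H; rewrite -lift_mul; first by rewrite !mulgA mulgK.
move=> t; rewrite -[t](conjgKV x); move: (t ^ x^-1) => r.
rewrite (inv_quot sysN) -conjgM mulKVg (inv_quot sysN) => /H ->.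
by rewrite addbb.
Qed.

Lemma lift1 : lift 1 = 1.
Proof. by rewrite lift_twist // /tbraid_delta; congr pair; apply: val_inj; rewrite subgK. Qed.
End TwistedLift.

(** * Parabolic subgroups and their longest elements *)

(* The reflections of a standard parabolic subgroup, without reference to its
   simple reflections. *)
Record parabolic_reflections (gT : finGroupType) (W : {group gT})
    (N : gT -> {set gT}) (A : {set gT}) : Prop := ParabolicReflections {
  par_sub : A \subset W;
  par_order : forall t, t \in A -> (t * t = 1)%g;
  par_self : forall t, t \in A -> t \in N t;
  par_norm : (<<A>> \subset 'N(A))%g;
  par_inv : forall u, u \in <<A>>%g -> N u \subset A
}.

Section Parabolic.
Context (gT : finGroupType) (W : {group gT}) (S : {set gT}) (delta : gT).
Context (nS : delta \in 'N(S)%g) (sdW : (W ><| <[delta]> = [set: gT])%g).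
Context (N : gT -> {set gT}) (sysN : inversion_system W S N).
Context (Ndelta : N delta = finset.set0).
Implicit Types (t x y u : gT) (A B : {set gT}).
Local Notation lift := (tbraid_lift nS W).
Local Open Scope group_scope.

Lemma par_subW A u : parabolic_reflections W N A -> u \in <<A>> -> u \in W.
Proof.
by move=> parA; apply: (fintype.subsetP _ u); rewrite gen_subG (par_sub parA).
Qed.

Lemma par_conj A t u : parabolic_reflections W N A -> u \in <<A>> ->
  (t ^ u \in A) = (t \in A).
Proof.
by move=> parA uA; rewrite memJ_norm // (fintype.subsetP (par_norm parA)).
Qed.

Lemma par_notin A t u : parabolic_reflections W N A -> u \in <<A>> ->
  t \notin A -> t \in N u = false.
Proof.
by move=> parA /(par_inv parA)/fintype.subsetP sub /negPf tA;
  apply/negP => /sub; rewrite tA.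
Qed.

(** If some [t] in [A] were not an inversion of the longest element [w], it would be one of [t * w],
    making [t * w] strictly longer. *)
Lemma longest_eltP A : parabolic_reflections W N A ->
  longest_elt S <<A>> \in <<A>> /\ N (longest_elt S <<A>>) = A.
Proof.
move=> parA; rewrite /longest_elt; case: arg_maxnP => [|w wA max_w].
  exact: group1.
split=> //; apply/eqP; rewrite finset.eqEsubset (par_inv parA) //=.
apply/fintype.subsetP => t tA; apply: contraT => tw.
have twA : t * w \in <<A>> by rewrite groupMl // mem_gen.
have := max_w _ twA; rewrite !(cox_lengthE sysN) ?(par_subW parA) //.
rewrite /= leqNgt => /negP[]; rewrite -{1}[w]mul1g -(par_order parA tA) -mulgA.
apply: (card_inv_lt_twist sdW sysN Ndelta).
by rewrite (inv_mul sysN) (par_self parA) // conjg_self (negPf tw).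
Qed.

(** Take an element of the coset [<<A>> x] with the fewest inversions; an inversion [t] in [A] would
    give a shorter element of the same coset. *)
Lemma min_coset_rep A x : parabolic_reflections W N A ->
  exists2 u, u \in <<A>> & forall t, t \in A -> t \in N (u * x) = false.
Proof.
move=> parA.
have [u uA min_u] :=
  @arg_minnP _ (1 : gT) (mem <<A>>) (fun u => #|N (u * x)%g|) (group1 _).
exists u => // t tA; apply/negP => /(card_inv_lt_twist sdW sysN Ndelta).
rewrite mulgA ltnNge => /negP[]; apply: min_u.
by rewrite inE groupMl // mem_gen.
Qed.

Section LongestElement.
Context (A : {set gT}) (parA : parabolic_reflections W N A).
Local Notation wA := (longest_elt S <<A>>).

Lemma longest_mem : wA \in <<A>>. Proof. exact: (longest_eltP parA).1. Qed.
Lemma inv_longest : N wA = A. Proof. exact: (longest_eltP parA).2. Qed.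

Lemma longest_unique u : u \in <<A>> -> N u = A -> u = wA.
Proof.
move=> uA Nu; apply: (inv_inj sysN); last by rewrite Nu inv_longest.
by rewrite (par_subW parA) // groupMl ?groupV ?longest_mem.
Qed.

Lemma longestV : wA^-1 = wA.
Proof.
apply: longest_unique; first by rewrite groupV longest_mem.
apply/setP => t; rewrite -[t](conjgKV wA) (inv_invg sysN).
by rewrite inv_longest (par_conj _ parA longest_mem).
Qed.

Lemma lift_longest_split u : u \in <<A>> ->
  lift wA = lift u * lift (u^-1 * wA).
Proof.
move=> uA; have := lift_mid nS sdW sysN Ndelta (x := 1) (y := u) (z := wA).
rewrite invg1 !mul1g; apply => t.
rewrite (inv1 sysN) inE inv_longest => /= tu; rewrite tu.
by rewrite (fintype.subsetP (par_inv parA uA)).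
Qed.

(* Both sides factor through [lift (u^-1 * wA)]. *)
Lemma lift_longest_comm u : u \in <<A>> ->
  lift u * lift wA = lift wA * lift (u ^ wA).
Proof.
move=> uA; have uwA : u ^ wA \in <<A>> by rewrite groupJ ?longest_mem.
have E : u^-1 * wA = (wA^-1)^-1 * (u ^ wA)^-1.
  by rewrite invgK -conjVg conjgE mulgA mulgV mul1g.
have E2 : lift wA = lift (u^-1 * wA) * lift (u ^ wA).
  have := lift_mid nS sdW sysN Ndelta
    (x := wA^-1) (y := (u ^ wA)^-1) (z := 1).
  rewrite -E !invgK !mulg1; apply => t.
  rewrite (inv1 sysN) inE longestV inv_longest.
  have uwA' : (u ^ wA)^-1 \in <<A>> by rewrite groupV.
  by have [tA|tA] := boolP (t \in A); [case: (t \in N _)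
    |rewrite (par_notin parA uwA' tA)].
by rewrite [in LHS]E2 mulgA -lift_longest_split.
Qed.
End LongestElement.
End Parabolic.

(** * Galleries and half turns *)

Section HalfTurns.
Context (gT : finGroupType) (W : {group gT}) (S : {set gT}) (delta : gT).
Context (nS : delta \in 'N(S)%g) (sdW : (W ><| <[delta]> = [set: gT])%g).
Context (N : gT -> {set gT}) (sysN : inversion_system W S N).
Context (Ndelta : N delta = finset.set0).
Implicit Types (t x y u z : gT) (A B : {set gT}).
Local Notation lift := (tbraid_lift nS W).
Local Open Scope group_scope.

(** The position after [k] half turns; successive half turns then move by [z] and [z^-1] in turn. *)
Definition alternate z (k : nat) : gT := if odd k then z else 1.

Lemma inv_alternate z k t : (t \in N (alternate z k)) = odd k && (t \in N z).
Proof. by rewrite /alternate; case: odd; rewrite // (inv1 sysN) inE. Qed.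

Definition half_turns z (m : nat) : tbraid_of nS :=
  \prod_(0 <= k < m) lift ((alternate z k)^-1 * alternate z k.+1).

Lemma half_turnsS z m :
  half_turns z m.+1 =
    half_turns z m * lift ((alternate z m)^-1 * alternate z m.+1).
Proof. by rewrite /half_turns big_nat_recr. Qed.

(* [K j] is the number of half turns completed at time [j]: between two
   multiples of a half turn each hyperplane of [N z] is crossed once. *)
Lemma gallery_half_turns (q : nat -> gT) (K : nat -> nat) z n :
  q 0%N = 1 -> K 0%N = 0%N -> (forall j, N (q j) \subset N z) ->
  (forall j, (j < n)%N ->
     (K j.+1 = K j /\ forall t, t \in N z ->
        (t \in N (q j)) != odd (K j) -> t \in N (q j.+1) = (t \in N (q j))) \/
     (K j.+1 = (K j).+1 /\ forall t, t \in N z ->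
        (t \in N (q j)) = odd (K j) -> t \in N (q j.+1) = ~~ odd (K j))) ->
  \prod_(0 <= j < n) lift ((q j)^-1 * q j.+1) =
    half_turns z (K n) * lift ((alternate z (K n))^-1 * q n).
Proof.
move=> q0 K0 qz; elim: n => [|n IH] step.
  rewrite big_nil K0 q0 /half_turns big_nil /alternate mulVg.
  by rewrite (lift1 nS sdW sysN) mulg1.
rewrite big_nat_recr //= IH => [|j lt_j]; last by apply: step; rewrite ltnW.
have notin j t : t \notin N z -> t \in N (q j) = false.
  by move=> tz; apply/negP => /(fintype.subsetP (qz j)); apply/negP.
case: (step n (ltnSn n)) => -[-> stepn].
  rewrite -mulgA -(lift_mid nS sdW sysN Ndelta) // => t.
  rewrite inv_alternate; have [tz|tz] := boolP (t \in N z).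
    rewrite andbT addbC => neq; rewrite stepn //.
    by move: neq; case: (t \in _); case: odd.
  by rewrite !notin // andbF.
(* A half turn ends during this step: the step is cut at the turning chamber [alternate z (K n).+1],
   and the half turn leading there is cut at [q n]. *)
rewrite half_turnsS (@lift_mid _ _ _ _ nS sdW _ sysN Ndelta
  (q n) (alternate z (K n).+1) (q n.+1)).
  rewrite (@lift_mid _ _ _ _ nS sdW _ sysN Ndelta
    (alternate z (K n)) (q n) (alternate z (K n).+1)) ?mulgA // => t.
  rewrite !inv_alternate /=; have [tz|tz] := boolP (t \in N z).
    by rewrite !andbT; case: (t \in N _); case: odd.
  by rewrite !notin // !andbF.
move=> t; rewrite inv_alternate /=; have [tz|tz] := boolP (t \in N z).
  rewrite !andbT => neq; rewrite stepn //.
  by move: neq; case: (t \in _); case: odd.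
by rewrite !notin // andbF.
Qed.

Section Step.
Context (A B : {set gT}) (sBA : B \subset A).
Context (parA : parabolic_reflections W N A).
Context (parB : parabolic_reflections W N B).
Local Notation wA := (longest_elt S <<A>>).
Local Notation wB := (longest_elt S <<B>>).
Local Notation turn := (wB^-1 * wA).

Lemma longest_sub : wB \in <<A>>.
Proof.
apply: (fintype.subsetP (genS sBA)).
exact: (longest_mem sdW sysN Ndelta parB).
Qed.

(** The hyperplanes between [wB C] and [wA C] are those of [A] outside [B], and conjugation by [wB]
    preserves both sets. *)
Lemma inv_turn t : (t \in N turn) = (t \in A) && (t \notin B).
Proof.
rewrite -[t](conjgKV wB) (inv_quot sysN) !conjgKV.
have NA := inv_longest sdW sysN Ndelta parA.
have NB := inv_longest sdW sysN Ndelta parB.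
rewrite NA NB -[t in RHS](conjgKV wB) (par_conj _ parA longest_sub).
rewrite (par_conj _ parB (longest_mem sdW sysN Ndelta parB)).
have := fintype.subsetP sBA (t ^ wB^-1).
by case: (_ \in B) => [->|] //; rewrite andbT.
Qed.

Lemma longest_sq : wA * wA = 1.
Proof. by rewrite -{1}(longestV sdW sysN Ndelta parA) mulVg. Qed.

(** Moving [lift wB] across [lift wA ^+ m] conjugates it by [wA] once per factor and yields [b m];
    what is missing from [b m] to [lift wA] is exactly the next half turn. *)
Lemma half_turns_longest m :
  lift wB ^+ m * half_turns turn m = lift wA ^+ m.
Proof.
have wAA := longest_mem sdW sysN Ndelta parA.
pose b k := lift (if odd k then wB ^ wA else wB).
have b_mem k : (if odd k then wB ^ wA else wB) \in <<A>>.
  by case: odd; rewrite ?groupJ ?longest_sub.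
have comm k : lift wB * lift wA ^+ k = lift wA ^+ k * b k.
  elim: k => [|k IH]; first by rewrite mulg1 mul1g.
  rewrite expgSr mulgA IH -mulgA.
  rewrite (lift_longest_comm nS sdW sysN Ndelta parA (b_mem k)) mulgA.
  congr (_ * lift _); rewrite /=; case: odd => //.
  by rewrite -conjgM longest_sq conjg1.
elim: m => [|m IH]; first by rewrite /half_turns big_nil mulg1.
rewrite expgS half_turnsS mulgA -(mulgA (lift wB)) IH comm -mulgA expgSr.
congr (_ * _); rewrite (lift_longest_split nS sdW sysN Ndelta parA (b_mem m)).
congr (_ * lift _); rewrite /alternate /=; case: odd => /=.
  rewrite mulg1 invMg invgK -conjVg conjgE -!mulgA longest_sq mulg1.
  by rewrite !(longestV sdW sysN Ndelta).
by rewrite invg1 mul1g.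
Qed.

(** Since [x] preserves [A] and has no inversion in it, neither [x * u] nor [u ^ x^-1 * x] crosses a
    hyperplane twice. *)
Lemma lift_par_comm x u : x \in 'N(A) ->
  (forall t, t \in A -> t \in N x = false) -> u \in <<A>> ->
  lift x * lift u = lift (u ^ x^-1) * lift x.
Proof.
move=> nAx xA uA.
have memx t : (t ^ x \in A) = (t \in A) by rewrite memJ_norm.
have uxA : u ^ x^-1 \in <<A>>.
  by rewrite memJ_norm // groupV (fintype.subsetP (norm_gen _)).
rewrite -(lift_mul nS sdW sysN Ndelta); last first.
  move=> t tx; rewrite (par_notin parA uA) // memx.
  by apply: contraL tx => tA; rewrite xA.
rewrite conjgCV (lift_mul nS sdW sysN Ndelta) // => t.
move/(fintype.subsetP (par_inv parA uxA)) => tA.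
by rewrite xA // (par_conj _ parA uxA).
Qed.

Lemma longest_conj x : x \in 'N(A) ->
  (forall t, t \in A -> t \in N x = false) -> wA ^ x^-1 = wA.
Proof.
move=> nAx xA; have memx t : (t ^ x \in A) = (t \in A) by rewrite memJ_norm.
have memxV t : (t ^ x^-1 \in A) = (t \in A) by rewrite memJ_norm ?groupV.
have wAA := longest_mem sdW sysN Ndelta parA.
have wxA : wA ^ x^-1 \in <<A>>.
  by rewrite memJ_norm // groupV (fintype.subsetP (norm_gen _)).
apply: (longest_unique sdW sysN Ndelta parA wxA).
apply/eqP; rewrite finset.eqEsubset (par_inv parA) //=.
apply/fintype.subsetP => t tA; rewrite conjgE invgK (inv_mul sysN) xA //=.
rewrite (inv_mul sysN) (inv_longest sdW sysN Ndelta parA) memx tA /=.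
rewrite -[_ ^ wA](conjgKV x) (inv_invg sysN) xA // memxV.
by rewrite (par_conj _ parA wAA) memx.
Qed.

Lemma lift_longest_norm x n m : x \in 'N(A) ->
  (forall t, t \in A -> t \in N x = false) ->
  commute (lift x ^+ n) (lift wA ^+ m).
Proof.
move=> nAx xA; apply: commuteX2.
have wAA := longest_mem sdW sysN Ndelta parA.
by rewrite /commute (lift_par_comm nAx xA wAA) longest_conj.
Qed.

Lemma inv_expg_norm x n t : x \in 'N(A) ->
  (forall t, t \in A -> t \in N x = false) -> t \in A ->
  t \in N (x ^+ n) = false.
Proof.
move=> nAx xA; elim: n t => [|n IH] t tA; first by rewrite (inv1 sysN) inE.
by rewrite expgS (inv_mul sysN) xA // IH // memJ_norm.
Qed.

End Step.
End HalfTurns.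

(** * Comparison of powers for two nested parabolic subgroups *)

Section Rotation.
Context (gT : finGroupType) (W : {group gT}) (S : {set gT}) (delta : gT).
Context (nS : delta \in 'N(S)%g) (sdW : (W ><| <[delta]> = [set: gT])%g).
Context (N : gT -> {set gT}) (sysN : inversion_system W S N).
Context (Ndelta : N delta = finset.set0).
Implicit Types (t x y u z : gT).
Local Notation lift := (tbraid_lift nS W).
Local Open Scope group_scope.
Context (A B : {set gT}) (sBA : B \subset A).
Context (parA : parabolic_reflections W N A).
Context (parB : parabolic_reflections W N B).
Local Notation wA := (longest_elt S <<A>>).
Local Notation wB := (longest_elt S <<B>>).
Local Notation turn := (wB^-1 * wA).

Lemma lift_par_commX x u n : x \in 'N(A) ->
  (forall t, t \in A -> t \in N x = false) -> u \in <<A>> ->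
  lift x ^+ n * lift u = lift (u ^ x ^- n) * lift x ^+ n.
Proof.
move=> nAx xA uA; elim: n => [|n IH].
  by rewrite mulg1 mul1g invg1 conjg1.
have nGx : x \in 'N(<<A>>) by rewrite (fintype.subsetP (norm_gen _)).
have -> : u ^ x ^- n.+1 = (u ^ x ^- n) ^ x^-1 by rewrite -conjgM -invMg -expgS.
rewrite expgS -mulgA IH mulgA.
rewrite (lift_par_comm nS sdW sysN Ndelta parA nAx xA) ?mulgA //.
by rewrite memJ_norm ?groupV ?groupX.
Qed.

(** Dividing [y ^+ j] by [x ^+ j] leaves a gallery in [<<A>>] that crosses only hyperplanes of [A]
    outside [B]; it lifts to half turns, which [lift wB ^+ K n] completes to a power of [lift wA].
    In the hypotheses, [(t \in N (y ^+ j)) != odd (K j)] means that [t] has been crossed since the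
    last completed half turn. *)
Lemma lift_rotation (x u : gT) (K : nat -> nat) n (y := u * x) :
  x \in 'N(A) -> (forall t, t \in A -> t \in N x = false) ->
  y \in 'N(B) -> (forall t, t \in B -> t \in N y = false) ->
  u \in <<A>> -> K 0%N = 0%N ->
  (forall j, (j < n)%N ->
     (K j.+1 = K j /\ forall t, t \in A -> t \notin B ->
        (t \in N (y ^+ j)) != odd (K j) ->
        t \in N (y ^+ j.+1) = (t \in N (y ^+ j))) \/
     (K j.+1 = (K j).+1 /\ forall t, t \in A -> t \notin B ->
        (t \in N (y ^+ j)) = odd (K j) ->
        t \in N (y ^+ j.+1) = ~~ odd (K j))) ->
  (forall t, t \in A -> t \notin B -> t \in N (y ^+ n) = odd (K n)) ->
  lift y ^+ n * lift wB ^+ K n = lift x ^+ n * lift wA ^+ K n.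
Proof.
move=> nAx xA nBy yB uA K0 step last_step.
have inv_turnE := inv_turn sdW sysN Ndelta sBA parA parB.
have nAy : y \in 'N(A) by rewrite groupM // (fintype.subsetP (par_norm parA)).
have nGx : x \in 'N(<<A>>) by rewrite (fintype.subsetP (norm_gen _)).
pose q j := y ^+ j * x ^- j.
have qS j : q j.+1 = u * (q j) ^ x^-1.
  by rewrite /q !expgS invMg /y conjgE invgK !mulgA.
have q_mem j : q j \in <<A>>.
  elim: j => [|j IH]; first by rewrite /q mulgV group1.
  by rewrite qS groupM // memJ_norm ?groupV.
have inv_q j t : t \in A -> (t \in N (q j)) = (t \in N (y ^+ j)).
  move=> tA; rewrite (inv_mul sysN) -[t ^ _](conjgKV (x ^+ j)).
  rewrite (inv_invg sysN) (inv_expg_norm sysN _ nAx xA) ?addbF //.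
  by rewrite !memJ_norm ?groupV ?groupX.
have q_turn j : N (q j) \subset N turn.
  apply/fintype.subsetP => t tq.
  have tA := fintype.subsetP (par_inv parA (q_mem j)) t tq.
  rewrite inv_turnE tA /=; apply: contraL tq => tB; rewrite inv_q //.
  apply/negbT; elim: j t tA tB => [|j IH] t tA tB.
    by rewrite (inv1 sysN) inE.
  by rewrite expgS (inv_mul sysN) yB //= IH // memJ_norm.
have q0 : q 0%N = 1 by rewrite /q mulgV.
have E := gallery_half_turns (n := n) nS sdW sysN Ndelta q0 K0 q_turn.
move: E => /(_ _)/wrap[|E].
  move=> j /step; case=> -[EK stepj]; [left|right]; split=> // t;
    rewrite inv_turnE => /andP[tA tB]; rewrite !inv_q //; exact: stepj.
(* By the final hypothesis the gallery stops at the end of a half turn: [q n] has either all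
   inversions of [turn] or none. *)
have q_last : q n = alternate turn (K n).
  apply: (inv_inj sysN).
    apply: (par_subW parA); rewrite groupM ?groupV // /alternate.
    case: odd; rewrite // groupM ?groupV ?(longest_mem sdW sysN Ndelta parA) //.
    exact: (longest_sub sdW sysN Ndelta sBA parB).
  apply/setP=> t; rewrite (inv_alternate sysN) inv_turnE.
  have [tA|tA] := boolP (t \in A); last first.
    by rewrite andbF (par_notin parA (q_mem n)).
  have [tB|tB] := boolP (t \in B); last by rewrite andbT inv_q // last_step.
  rewrite andbF; apply: contraTF tB => /(fintype.subsetP (q_turn n)).
  by rewrite inv_turnE => /andP[].
rewrite q_last mulVg (lift1 nS sdW sysN) mulg1 in E.
have lift_y : lift y = lift u * lift x.
  rewrite /y (lift_mul nS sdW sysN Ndelta) // => t.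
  move/(fintype.subsetP (par_inv parA uA)) => tA.
  by rewrite xA // (par_conj _ parA uA).
have Ey : lift y ^+ n = half_turns W nS turn (K n) * lift x ^+ n.
  rewrite -E; elim: n {step last_step E q_last} => [|n IH].
    by rewrite big_nil mulg1.
  have Eq : (q n)^-1 * q n.+1 = u ^ x ^- n.
    rewrite /q invMg invgK !expgSr invMg conjgE invgK /y -!mulgA.
    by rewrite mulKg mulKVg.
  rewrite big_nat_recr //= Eq expgSr IH lift_y [in LHS]mulgA.
  rewrite -[X in X * _ = _]mulgA lift_par_commX // [in RHS]expgSr.
  by rewrite !mulgA.
(* Each longest element commutes with the power it stands beside, so [lift wB ^+ K n] can be brought
   next to the half turns and the resulting [lift wA ^+ K n] moved back. *)
rewrite (lift_longest_norm nS sdW sysN Ndelta parB _ _ nBy yB) Ey mulgA.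
rewrite (half_turns_longest nS sdW sysN Ndelta sBA parA parB).
by rewrite (lift_longest_norm nS sdW sysN Ndelta parA _ _ nAx xA).
Qed.
End Rotation.

(** * Inner products and reflections *)

Section DotProduct.
Context (R : realType) (V : normedVectType R) (ip : {dot V for idfun}).
Implicit Types u v : V.

Lemma ipC u v : ip u v = ip v u.
Proof. by rewrite (hermC ip) expr0 mul1r. Qed.

Lemma ipDr u v1 v2 : ip u (v1 + v2) = ip u v1 + ip u v2.
Proof. exact: linearDr. Qed.
Lemma ipBr u v1 v2 : ip u (v1 - v2) = ip u v1 - ip u v2.
Proof. exact: linearBr. Qed.
Lemma ipZr a u v : ip u (a *: v) = a * ip u v.
Proof. by rewrite linearZr. Qed.
Lemma ipNr u v : ip u (- v) = - ip u v.
Proof. exact: linearNr. Qed.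
Lemma ipDl u v1 v2 : ip (v1 + v2) u = ip v1 u + ip v2 u.
Proof. by rewrite !(ipC _ u) ipDr. Qed.
Lemma ipBl u v1 v2 : ip (v1 - v2) u = ip v1 u - ip v2 u.
Proof. by rewrite !(ipC _ u) ipBr. Qed.
Lemma ipZl a u v : ip (a *: v) u = a * ip v u.
Proof. by rewrite !(ipC _ u) ipZr. Qed.
Lemma ipNl u v : ip (- v) u = - ip v u.
Proof. by rewrite !(ipC _ u) ipNr. Qed.
Lemma ip0r u : ip u 0 = 0. Proof. exact: linear0r. Qed.

Lemma ip_gt0 u : u != 0 -> 0 < ip u u.
Proof. exact: neq0_dnorm_gt0. Qed.

Lemma ip_ge0 u : 0 <= ip u u.
Proof. by have [->|/ip_gt0/ltW//] := eqVneq u 0; rewrite ip0r. Qed.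

Lemma ip_eq0 u : ip u u = 0 -> u = 0.
Proof. by move=> E; apply: contra_eq E => /ip_gt0/lt0r_neq0. Qed.

Lemma cauchy_schwarz_ip u v : (ip u v) ^+ 2 <= ip u u * ip v v.
Proof.
have [->|v0] := eqVneq v 0; first by rewrite !ip0r expr0n mulr0.
have vv : 0 < ip v v by exact: ip_gt0.
have := ip_ge0 (ip v v *: u - ip u v *: v).
rewrite !(ipBl, ipBr, ipZl, ipZr) (ipC v u) => H.
have : 0 <= ip v v * (ip u u * ip v v - ip u v ^+ 2).
  apply: le_trans H _; rewrite le_eqVlt; apply/orP; left; apply/eqP; ring.
by rewrite pmulr_rge0 // subr_ge0.
Qed.

Lemma continuous_ip (norm_ip : inner_norm ip) a : continuous (ip a).
Proof.
have lin : linear (ip a : V -> R^o) by move=> k u v; rewrite ipDr ipZr.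
pose f : {linear V -> R^o} := HB.pack (ip a : V -> R^o)
   (GRing.isLinear.Build R V R^o _ (ip a : V -> R^o) lin).
apply: (@bounded_linear_continuous _ _ _ f); apply/linear_boundedP.
near=> r => x; have le_r : Num.sqrt (ip a a) <= r.
  by near: r; apply: nbhs_pinfty_ge; rewrite num_real.
rewrite -[`|f x|]/(`|ip a x|) norm_ip.
apply: (@le_trans _ _ (Num.sqrt (ip a a) * Num.sqrt (ip x x))).
  by rewrite -sqrtrM ?ip_ge0 // -sqrtr_sqr ler_wsqrtr // cauchy_schwarz_ip.
by rewrite ler_wpM2r ?sqrtr_ge0.
Unshelve. all: by end_near.
Qed.

Lemma exists_orthogonal (H : {vspace V}) : (\dim H < \dim {:V})%N ->
  exists2 v, v != 0 & {in H, forall u, ip u v = 0}.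
Proof.
move=> ltH.
pose phi (v : V) : 'rV[R]_(\dim H) := \row_i ip ((vbasis H)`_i) v.
have lin : linear phi.
  by move=> k u v; apply/rowP => i; rewrite !mxE ipDr ipZr.
pose f := linfun (HB.pack phi (GRing.isLinear.Build R V _ _ phi lin) : {linear V -> _}).
have : lker f != 0%VS.
  apply: contraTneq ltH => ker0; rewrite -leqNgt.
  have := limg_ker_dim f {:V}; rewrite ker0 capv0 dimv0 add0n => <-.
  by rewrite (leq_trans (dimvS (subvf _))) // dimvf /dim /= mul1n.
rewrite -vpick0 => v0; exists (vpick (lker f)) => // u uH.
have := memv_pick (lker f); rewrite memv_ker lfunE /= => /eqP/rowP ker.
rewrite (coord_vbasis uH).
apply: (big_ind (fun w => ip w (vpick (lker f)) = 0)) => [|w1 w2 e1 e2|i _].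
- by rewrite ipC ip0r.
- by rewrite ipDl e1 e2 addr0.
- by have := ker i; rewrite !mxE ipZl => ->; rewrite mulr0.
Qed.
End DotProduct.

Section Reflections.
Context (R : realType) (V : normedVectType R) (ip : {dot V for idfun}).
Context (gT : finGroupType) (W : {group gT}) (rho : gT -> 'End(V)).
Context (rho_rep : orth_rep ip rho).
Implicit Types (t x y : gT) (u v a : V) (H F : {vspace V}).

Lemma eq_oppv a : a = - a -> a = 0.
Proof.
move=> E; have : (2 : R) *: a = 0 by rewrite scaler_nat mulr2n {1}E addNr.
by move/eqP; rewrite scaler_eq0 pnatr_eq0 /= => /eqP.
Qed.

Lemma rho1 v : rho 1%g v = v.
Proof. by case: rho_rep => -> _ _ _; rewrite id_lfunE. Qed.

Lemma rhoM x y v : rho (x * y)%g v = rho x (rho y v).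
Proof. by case: rho_rep => _ -> _ _; rewrite comp_lfunE. Qed.

Lemma rho_inj x y : (forall v, rho x v = rho y v) -> x = y.
Proof. by case: rho_rep => _ _ inj _ E; apply/inj/lfunP. Qed.

Lemma ip_rho x u v : ip (rho x u) (rho x v) = ip u v.
Proof. by case: rho_rep. Qed.

Lemma rhoK x v : rho x^-1%g (rho x v) = v.
Proof. by rewrite -rhoM mulVg rho1. Qed.

Lemma rhoVK x v : rho x (rho x^-1%g v) = v.
Proof. by rewrite -rhoM mulgV rho1. Qed.

Lemma ip_rhoV x u v : ip u (rho x v) = ip (rho x^-1%g u) v.
Proof. by rewrite -(ip_rho x^-1) rhoK. Qed.

Lemma hyperplane_decomp H a : (\dim H).+1 = \dim {:V} -> a \notin H ->
  forall v, exists2 h, h \in H & exists k, v = h + k *: a.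
Proof.
move=> dimH aH v.
have : v \in (H + <[a]>)%VS.
  have /eqP -> : (H + <[a]> == {:V})%VS.
    rewrite eqEdim subvf /= -dimH ltn_neqAle dimvS ?addvSl // andbT.
    apply: contraNN aH => /eqP dimE.
    have /eqP -> : (H == H + <[a]>)%VS by rewrite eqEdim addvSl dimE /=.
    by rewrite (subvP (addvSr H <[a]>)) ?memv_line.
  exact: memvf.
move=> /memv_addP[h hH [b /vlineP[k ->] ->]]; exists h => //.
by exists k.
Qed.

Section OneReflection.
Context (t : gT) (H : {vspace V}) (reflH : orth_refl ip H (rho t)).

Lemma refl_neg_notin a : a != 0 -> rho t a = - a -> a \notin H.
Proof.
case: reflH => _ fixH _ a0 ta; apply: contra_neqN a0 => /fixH.
by rewrite ta => /esym/eq_oppv.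
Qed.

Lemma refl_neg_orth a u : rho t a = - a -> u \in H -> ip a u = 0.
Proof.
case: reflH => _ fixH _ ta uH; have := ip_rho t a u.
by rewrite ta fixH // ipNl => E; lra.
Qed.

(** [v - rho t v] is orthogonal to [H], because [rho t] is an isometry fixing [H]; being negated by
    [rho t], it forces [rho t] to be an involution. *)
Lemma refl_sqr v : rho t (rho t v) = v.
Proof.
case: reflH => _ fixH negH.
have /negH : {in H, forall u, ip u (v - rho t v) = 0}.
  by move=> u uH; rewrite ipBr -{2}(fixH u uH) ip_rho subrr.
by rewrite linearB /= opprB => /addrI /oppr_inj.
Qed.

Lemma reflectionE a v : a != 0 -> rho t a = - a ->
  rho t v = v - (2 * ip a v / ip a a) *: a.
Proof.
move=> a0 ta; have aH := refl_neg_notin a0 ta.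
have [dimH fixH _] := reflH.
have [h hH [k ->]] := hyperplane_decomp dimH aH v.
rewrite linearD linearZ /= fixH // ta ipDr ipZr refl_neg_orth // add0r.
rewrite mulrA mulfK ?lt0r_neq0 ?ip_gt0 // scalerN -addrA; congr (_ + _).
by rewrite -scalerBl -scaleNr; congr (_ *: _); ring.
Qed.

Lemma refl_exists_neg : exists2 a, a != 0 & rho t a = - a.
Proof.
have [dimH fixH negH] := reflH.
have [|a a0 /negH] := @exists_orthogonal _ _ ip H; first by rewrite dimH.
by exists a.
Qed.

Lemma refl_fixed v : (v \in H) = (rho t v == v).
Proof.
have [dimH fixH negH] := reflH.
apply/idP/eqP => [/fixH//|tv]; apply: contraT => vH.
have [a a0 ta] := refl_exists_neg.
have [h hH [k Ea]] := hyperplane_decomp dimH vH a.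
have : rho t a = a by rewrite Ea linearD linearZ /= fixH // tv.
by rewrite ta => /esym/eq_oppv E; rewrite E eqxx in a0.
Qed.

Lemma refl_conj x : exists H', orth_refl ip H' (rho (t ^ x)%g).
Proof.
have [dimH fixH negH] := reflH.
exists (rho x^-1%g @: H)%VS; split.
- rewrite limg_dim_eq // (_ : lker (rho x^-1%g) = 0%VS) ?capv0 //.
  apply/eqP/lker0P => u v /(congr1 (rho x)); by rewrite !rhoVK.
- move=> v /memv_imgP[u uH ->].
  by rewrite conjgE !rhoM rhoVK fixH.
- move=> v orth; rewrite conjgE !rhoM negH ?linearN /= ?rhoK // => u uH.
  by rewrite ip_rhoV orth // memv_img.
Qed.
End OneReflection.
End Reflections.

(** * Roots and inversion sets *)

Section Roots.
Context (R : realType) (V : normedVectType R) (ip : {dot V for idfun}).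
Context (gT : finGroupType) (W : {group gT}) (rho : gT -> 'End(V)).
Context (rho_rep : orth_rep ip rho) (nW : ([set: gT] \subset 'N(W))%g).
Implicit Types (t x y : gT) (u v a : V) (H F : {vspace V}).

Definition reflections : {set gT} :=
  [set t in W | `[< exists H, orth_refl ip H (rho t) >]]%SET.

Lemma reflectionsP t : reflect
  (t \in W /\ exists H, orth_refl ip H (rho t)) (t \in reflections).
Proof.
by rewrite inE; apply: (iffP andP) => -[tW /asboolP]; split=> //; apply/asboolP.
Qed.

Lemma mem_reflectionsJ t x : (t ^ x \in reflections)%g = (t \in reflections).
Proof.
have impl r y : r \in reflections -> (r ^ y \in reflections)%g.
  move=> /reflectionsP[rW [H reflH]]; apply/reflectionsP; split.
    by rewrite memJ_norm // (fintype.subsetP nW) ?inE.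
  exact: refl_conj reflH y.
by apply/idP/idP => [tx|/impl//]; rewrite -(conjgK x t) impl.
Qed.

Lemma reflections_sqr t : t \in reflections -> (t * t = 1)%g.
Proof.
move=> /reflectionsP[_ [H reflH]]; apply: (rho_inj rho_rep) => v.
by rewrite (rhoM rho_rep) (refl_sqr rho_rep reflH) (rho1 rho_rep).
Qed.

Lemma reflectionsV t : t \in reflections -> (t^-1 = t)%g.
Proof. by move=> /reflections_sqr E; apply/eqP; rewrite eq_invg_mul E. Qed.

Context (c : V) (c_reg : forall t, t \in reflections -> rho t c != c).

(** A normal vector of the hyperplane of [t], pointing to the side of [c]. Its length is not
    normalized, so the group permutes the roots only up to scalars. *)
Definition root t : V := c - rho t c.

Lemma root_neq0 t : t \in reflections -> root t != 0.
Proof. by move=> /c_reg; rewrite /root subr_eq0 eq_sym. Qed.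

Lemma root_neg t : t \in reflections -> rho t (root t) = - root t.
Proof.
move=> /reflectionsP[_ [H reflH]].
by rewrite /root linearB /= (refl_sqr rho_rep reflH) opprB.
Qed.

Lemma root_base t : t \in reflections -> 0 < ip (root t) c.
Proof.
move=> tT; have := ip_gt0 ip (root_neq0 tT).
rewrite {2}/root ipBr (ip_rhoV rho_rep) (_ : rho t^-1%g (root t) = - root t).
  by rewrite ipNl; lra.
by rewrite reflectionsV // root_neg.
Qed.

Lemma root_reflectionE t v : t \in reflections ->
  rho t v = v - (2 * ip (root t) v / ip (root t) (root t)) *: root t.
Proof.
move=> tT; have /reflectionsP[_ [H reflH]] := tT.
by apply: (reflectionE rho_rep reflH); rewrite ?root_neq0 ?root_neg.
Qed.

Lemma root_fixed t v : t \in reflections ->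
  (rho t v == v) = (ip (root t) v == 0).
Proof.
move=> tT; rewrite root_reflectionE // -subr_eq0 addrAC subrr add0r oppr_eq0.
rewrite scaler_eq0 (negPf (root_neq0 tT)) orbF mulf_eq0 invr_eq0.
by rewrite (gt_eqF (ip_gt0 ip (root_neq0 tT))) orbF mulf_eq0 pnatr_eq0.
Qed.

(** The transported root is negated by [t ^ x], hence lies on the line of its root. The sign of [l]
    is left open: it tells on which side of the hyperplane of [t] the point [rho x c] lies. *)
Lemma root_conj t x : t \in reflections ->
  exists2 l, l != 0 & rho x^-1%g (root t) = l *: root (t ^ x)%g.
Proof.
move=> tT; set b := rho _ _; set a := root _.
have txT : (t ^ x)%g \in reflections by rewrite mem_reflectionsJ.
have neg_b : rho (t ^ x)%g b = - b.
  by rewrite conjgE !(rhoM rho_rep) (rhoVK rho_rep) root_neg // linearN.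
have b0 : b != 0.
  apply: contra_neq (root_neq0 tT) => b0.
  by rewrite -(rhoVK rho_rep x (root t)) -/b b0 linear0.
have Eb : b = (ip a b / ip a a) *: a.
  have := root_reflectionE b txT; rewrite neg_b -/a -mulrA -scalerA => E.
  apply/eqP; rewrite -subr_eq0; apply/eqP.
  have : (2 : R) *: (b - (ip a b / ip a a) *: a) = 0.
    by rewrite scalerBr {1}scaler_nat mulr2n -addrA -E subrr.
  by move/eqP; rewrite scaler_eq0 pnatr_eq0 => /eqP.
exists (ip a b / ip a a) => //.
by apply: contra_neq b0 => E; rewrite Eb E scale0r.
Qed.

Definition inversions x : {set gT} :=
  [set t in reflections | ip (root t) (rho x c) < 0]%SET.

Lemma mem_inversions x t : (t \in inversions x) =
  (t \in reflections) && (ip (root t) (rho x c) < 0).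
Proof. by rewrite [LHS]finset.in_set. Qed.

(** Testing at [c] or at [v] gives the sign of the same scalar from [root_conj]. So any vector on
    the positive side of [t ^ x] may replace [c], even one lying on other hyperplanes. *)
Lemma inversions_sign t x v : t \in reflections -> 0 < ip (root (t ^ x)%g) v ->
  (t \in inversions x) = (ip (root t) (rho x v) < 0)
  /\ ip (root t) (rho x v) != 0.
Proof.
move=> tT v_gt0; rewrite mem_inversions tT /= !(ip_rhoV rho_rep).
have [l l0 ->] := root_conj x tT; rewrite !ipZl.
have c_gt0 : 0 < ip (root (t ^ x)%g) c by rewrite root_base ?mem_reflectionsJ.
by rewrite !pmulr_llt0 // mulf_neq0 // gt_eqF.
Qed.

(** The root of [t] is carried by [x^-1] to a multiple of the root of [t ^ x]; the multiplier is
    negative exactly when [t] is an inversion of [x], and signs multiply. *)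
Lemma inversionsM x y t :
  (t \in inversions (x * y)%g) =
    (t \in inversions x) (+) ((t ^ x)%g \in inversions y).
Proof.
have [tT|tT] := boolP (t \in reflections); last first.
  by rewrite !mem_inversions mem_reflectionsJ (negPf tT).
have txT : (t ^ x)%g \in reflections by rewrite mem_reflectionsJ.
rewrite !mem_inversions tT txT /= (rhoM rho_rep) !(ip_rhoV rho_rep x).
have [l l0 ->] := root_conj x tT; rewrite !ipZl.
have c_gt0 : 0 < ip (root (t ^ x)%g) c by rewrite root_base.
have [|_] := @inversions_sign (t ^ x)%g y c txT.
  by rewrite root_base // !mem_reflectionsJ.
rewrite (pmulr_llt0 _ c_gt0); move: l0; case: (ltgtP l 0) => // l_lt _ neq0.
  by rewrite nmulr_rlt0 // lt_def neq0 leNgt.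
by rewrite pmulr_rlt0.
Qed.

Lemma inversions_self t : t \in reflections -> t \in inversions t.
Proof.
move=> tT; rewrite mem_inversions tT /= (ip_rhoV rho_rep).
rewrite (_ : rho t^-1%g (root t) = - root t) ?ipNl ?oppr_lt0 ?root_base //.
by rewrite reflectionsV // root_neg.
Qed.

Definition fixing F : {set gT} :=
  [set t in reflections | `[< forall v, v \in F -> rho t v = v >]]%SET.

Lemma fixingP F t : reflect
  (t \in reflections /\ forall v, v \in F -> rho t v = v) (t \in fixing F).
Proof.
rewrite [X in reflect _ X]finset.in_set; apply: (iffP andP) => -[tW /asboolP]; split=> //; apply/asboolP.
Qed.

Lemma root_fixing F t v : t \in fixing F -> v \in F -> ip (root t) v = 0.
Proof.
by move=> /fixingP[tT fixF] /fixF tv; apply/eqP; rewrite -root_fixed // tv.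
Qed.

Lemma gen_fixing F (u : gT) v : u \in <<fixing F>>%g -> v \in F -> rho u v = v.
Proof.
move=> /gen_prodgP[n [b bF ->]] vF.
apply: (big_ind (fun g => rho g v = v)) => [|x y ex ey|i _].
- exact: (rho1 rho_rep).
- by rewrite (rhoM rho_rep) ey.
- by have /fixingP[_] := bF i; apply.
Qed.

Lemma fixing_norm F x : (forall v, v \in F -> rho x v \in F) ->
  x \in 'N(fixing F)%g.
Proof.
move=> stabF; rewrite inE; apply/fintype.subsetP => r.
rewrite mem_conjg => /fixingP[]; rewrite mem_reflectionsJ => rT fixF.
apply/fixingP; split=> // v vF.
have := fixF _ (stabF v vF); rewrite conjgE invgK !(rhoM rho_rep).
by rewrite (rhoK rho_rep) => /(congr1 (rho x^-1%g)); rewrite !(rhoK rho_rep).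
Qed.

(** [u] fixes [f], and for [t] outside [fixing F] both [t] and [t ^ u] are positive on [f]. Testing
    the sign at [f] shows that such a [t] is no inversion of [u]. *)
Lemma fixing_parabolic F f : f \in F ->
  (forall t, t \in reflections -> t \notin fixing F -> 0 < ip (root t) f) ->
  parabolic_reflections W inversions (fixing F).
Proof.
move=> fF f_gt0.
have norm_gen_fixing : (<<fixing F>> \subset 'N(fixing F))%g.
  by apply/fintype.subsetP => u uF; apply: fixing_norm => v vF; rewrite (gen_fixing uF vF).
split=> //.
- by apply/fintype.subsetP => t /fixingP[/reflectionsP[]].
- by move=> t /fixingP[/reflections_sqr].
- by move=> t /fixingP[/inversions_self].
- move=> u uF; apply/fintype.subsetP => t tu; apply: contraLR (tu) => tF.
  have tT : t \in reflections by move: tu; rewrite mem_inversions => /andP[].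
  have [|->] := @inversions_sign t u f tT.
    rewrite f_gt0 ?mem_reflectionsJ // memJ_norm //.
    exact: (fintype.subsetP norm_gen_fixing).
  by rewrite (gen_fixing uF fF) -leNgt ltW // f_gt0.
Qed.
End Roots.

(** * The fundamental chamber *)

Section Separation.
Context (R : realType) (V : normedVectType R) (f : V -> R) (cf : continuous f).
Local Open Scope classical_set_scope.

Lemma connected_same_sign (D : set V) a b : connected D ->
  (forall x, D x -> f x != 0) -> D a -> D b -> 0 < f a -> 0 < f b.
Proof.
move=> connD f0 Da Db fa; rewrite ltNge; apply/negP => fb.
have : is_interval (f @` D).
  apply/connected_intervalP; apply: connected_continuous_connected => //.
  exact: continuous_subspaceT.
have Dfa : (f @` D) (f a) by exists a.
have Dfb : (f @` D) (f b) by exists b.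
move=> /(_ _ _ Dfb Dfa 0); rewrite fb ltW // => /(_ isT)[x Dx fx].
by have := f0 x Dx; rewrite fx eqxx.
Qed.

Lemma closure_ge0 (D : set V) b : (forall x, D x -> 0 < f x) ->
  closure D b -> 0 <= f b.
Proof.
move=> fD clb; rewrite leNgt; apply/negP => fb.
have : nbhs b [set x | f x < 0] by apply: cvgr_lt fb; exact: cf.
by move=> /clb[x [/fD/ltW fx /=]]; rewrite ltNge fx.
Qed.
End Separation.

Section Chamber.
Context (R : realType) (gT : finGroupType).
Context (W : {group gT}) (S : {set gT}) (delta : gT).
Context (coxWS : coxeter_system W S).
Context (V : normedVectType R) (ip : {dot V for idfun}).
Context (norm_ip : inner_norm ip) (rho : gT -> 'End(V)).
Context (rho_rep : orth_rep ip rho) (nW : ([set: gT] \subset 'N(W))%g).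
Context (rho_refl : forall s, s \in S -> exists H, orth_refl ip H (rho s)).
Context (C : set V) (C_fund : fundamental_chamber ip W rho S C).
Local Notation T := (reflections ip W rho).

Lemma reflections_hyps t H : t \in T -> orth_refl ip H (rho t) ->
  hyps ip W rho H.
Proof. by move=> /reflectionsP[tW _] reflH; exists t. Qed.

Lemma hyps_reflections H : hyps ip W rho H ->
  exists2 t, t \in T & orth_refl ip H (rho t).
Proof. by move=> [t tW reflH]; exists t => //; apply/reflectionsP; split; [|exists H]. Qed.

Lemma hyps_compl_notin (HH : set {vspace V}) H v :
  hyps_compl HH v -> HH H -> v \notin H.
Proof. by move=> Uv HHH; apply/negP => vH; apply: Uv; exists H. Qed.

Lemma chamber_center : exists2 c,
  (forall t, t \in T -> rho t c != c) &
  C = connected_component (hyps_compl (hyps ip W rho)) c.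
Proof.
have [[c Uc EC] _] := C_fund; exists c => // t tT.
have /reflectionsP[_ [H reflH]] := tT.
rewrite -(refl_fixed reflH).
exact: hyps_compl_notin Uc (reflections_hyps tT reflH).
Qed.

Context (c : V) (c_reg : forall t, t \in T -> rho t c != c).
Context (EC : C = connected_component (hyps_compl (hyps ip W rho)) c).
Local Notation rt := (root rho c).

Lemma center_compl : hyps_compl (hyps ip W rho) c.
Proof.
move=> [H /hyps_reflections[t tT reflH]] /=.
by rewrite (refl_fixed reflH); apply/negP/c_reg.
Qed.

Lemma center_chamber : C c.
Proof. by rewrite EC; apply: connected_component_refl; exact: center_compl. Qed.

Lemma root_hyperplane t H v : t \in T -> orth_refl ip H (rho t) ->
  (v \in H) = (ip (rt t) v == 0).
Proof.
by move=> tT reflH; rewrite (refl_fixed reflH) (root_fixed rho_rep c_reg).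
Qed.

Lemma component_root_gt0 (HH : set {vspace V}) (D : set V) t H :
  HH H -> t \in T -> orth_refl ip H (rho t) ->
  is_component (hyps_compl HH) D -> D c -> forall x, D x -> 0 < ip (rt t) x.
Proof.
move=> HHH tT reflH [v Uv ED] Dc x Dx.
apply: (connected_same_sign (@continuous_ip _ _ _ norm_ip (rt t)) _ _ Dc Dx).
- by rewrite ED; apply: component_connected.
- move=> y; rewrite ED => /connected_component_sub Uy.
  by rewrite -(root_hyperplane _ tT reflH) (hyps_compl_notin Uy).
- exact: (root_base rho_rep c_reg tT).
Qed.

Lemma chamber_root_gt0 t x : t \in T -> C x -> 0 < ip (rt t) x.
Proof.
move=> tT; have /reflectionsP[_ [H reflH]] := tT.
have hypH := reflections_hyps tT reflH; have [compC _] := C_fund.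
exact: component_root_gt0 hypH tT reflH compC center_chamber x.
Qed.

Lemma reflection_inj t1 t2 H : orth_refl ip H (rho t1) ->
  orth_refl ip H (rho t2) -> t1 = t2.
Proof.
move=> refl1 refl2; apply: (rho_inj rho_rep) => v.
have [a a0 t1a] := refl_exists_neg refl1.
have t2a : rho t2 a = - a.
  have [_ _ negH] := refl2; apply: negH => u uH.
  by rewrite ipC (refl_neg_orth rho_rep refl1).
by rewrite (reflectionE rho_rep refl1 v a0) // (reflectionE rho_rep refl2 v a0).
Qed.

Lemma simple_reflection s : s \in S -> s \in T.
Proof.
have [genS _ _] := coxWS.
by move=> sS; apply/reflectionsP; split; [rewrite -genS mem_gen|exact: rho_refl].
Qed.

(** The test vector is a point [v] in the closure of [C] lying on the wall of [s] and on no other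
    reflecting hyperplane: [rho s] fixes it, so only the root of [s] can change sign. *)
Lemma inversions_simple s : s \in S -> inversions ip W rho c s = [set s]%SET.
Proof.
move=> sS; have sT := simple_reflection sS.
have [H reflH] := rho_refl sS.
have [_ walls] := C_fund.
have [hypH [v clv [vH regv]]] : wall ip W rho C H by apply/walls; exists s.
apply/setP => t; rewrite inE; case: eqVneq => [->|neq_ts].
  exact: inversions_self.
apply/negbTE/negP => ts.
have tT : t \in T by move: ts; rewrite mem_inversions => /andP[].
have clC r : r \in T -> 0 <= ip (rt r) v.
  move=> rT; apply: (closure_ge0 (@continuous_ip _ _ _ norm_ip (rt r)) _ clv) => x.
  exact: chamber_root_gt0.
have pos r : r \in T -> r != s -> 0 < ip (rt r) v.
  move=> rT neq_rs; rewrite lt_def clC // andbT.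
  have /reflectionsP[_ [H' reflH']] := rT.
  rewrite -(root_hyperplane v rT reflH'); apply: contra_neqN neq_rs => vH'.
  have /= sHH' := regv _ (reflections_hyps rT reflH') vH'.
  have EH : H = H'.
    apply/eqP; rewrite eqEdim; apply/andP; split; first exact/subvP.
    by case: reflH => dimH _ _; case: reflH' => dimH' _ _; rewrite -ltnS dimH dimH'.
  by apply: reflection_inj reflH' _; rewrite -EH.
have [|Ets _] := inversions_sign rho_rep nW c_reg (x := s) (v := v) tT.
  rewrite pos // ?mem_reflectionsJ //; apply: contra_neq neq_ts => Ets.
  by rewrite -(conjgK s t) Ets conjgE invgK mulgV mulg1.
move: ts; rewrite Ets; have /eqP -> : rho s v == v.
  by rewrite -(refl_fixed reflH).
by rewrite ltNge clC.
Qed.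

Lemma inversions_system : inversion_system W S (inversions ip W rho c).
Proof.
have [genS ordS _] := coxWS; split => //; first exact: inversions_simple.
exact: inversionsM.
Qed.

Lemma inversions_twist (C_delta : (rho delta @` C)%classic = C) :
  inversions ip W rho c delta = finset.set0.
Proof.
have Cd : C (rho delta c) by rewrite -C_delta; exists c => //; exact: center_chamber.
apply/setP => t; rewrite mem_inversions finset.in_set0; apply/negbTE/negP => /andP[tT].
by rewrite ltNge ltW // chamber_root_gt0.
Qed.

(** * Good position and the reflections fixing the flag *)

Section GoodPosition.
Context (w : gT) (theta : seq R) (C_good : good_position ip W rho w theta C).
Local Notation F := (Fsum rho w theta).
Local Notation TF i := (fixing ip W rho (F i)).

Lemma fixing_hyps (G : {vspace V}) t H : t \in T -> orth_refl ip H (rho t) ->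
  (t \in fixing ip W rho G) <-> hyps_of ip W rho [set` G] H.
Proof.
move=> tT reflH; split=> [/fixingP[_ fixG]|[_ sGH]].
  split=> [|v vG /=]; first exact: reflections_hyps reflH.
  by rewrite (refl_fixed reflH) fixG.
apply/fixingP; split=> // v vG; apply/eqP.
by rewrite -(refl_fixed reflH); apply: sGH.
Qed.

Lemma refl_subgroupE (G : {vspace V}) :
  refl_subgroup ip W rho [set` G] = <<fixing ip W rho G>>%g.
Proof.
rewrite /refl_subgroup; congr <<_>>%g; apply/setP => t; rewrite inE.
apply/andP/idP => [[tW /asboolP[H hypH reflH]]|tG].
  by apply/(fixing_hyps _ _ reflH) => //; apply/reflectionsP; split; [|exists H].
have /fixingP[/[dup] tT /reflectionsP[tW [H reflH]] _] := tG.
by split=> //; apply/asboolP; exists H => //; apply/(fixing_hyps _ tT reflH).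
Qed.

Lemma Fsum_sub i v : v \in F i -> v \in F i.+1.
Proof.
move=> vF; rewrite /Fsum big_ord_recr /=.
exact: (subvP (addvSl _ _)).
Qed.

Lemma fixing_Fsum_sub i : TF i.+1 \subset TF i.
Proof.
apply/fintype.subsetP => t /fixingP[tT fixF]; apply/fixingP; split=> // v vF.
by rewrite fixF // Fsum_sub.
Qed.

(** Lying in the closure gives weak inequalities. If the root of [t] vanished at the regular point
    [v], its hyperplane would contain [F i.+1] and [t] would be in [TF i.+1]. *)
Lemma good_position_point i : (i < size theta)%N ->
  exists2 v, v \in F i.+1 &
    forall t, t \in TF i -> t \notin TF i.+1 -> 0 < ip (rt t) v.
Proof.
move=> /C_good[D [compD sCD [v clv [vF regv]]]]; exists v => // t tF tF1.
have /fixingP[tT _] := tF; have /reflectionsP[_ [H reflH]] := tT.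
rewrite lt_def; apply/andP; split; last first.
  apply: (closure_ge0 (@continuous_ip _ _ _ norm_ip (rt t)) _ clv).
  have hypH := (fixing_hyps (F i) tT reflH).1 tF.
  exact: component_root_gt0 hypH tT reflH compD (sCD _ center_chamber).
rewrite -(root_hyperplane v tT reflH); apply: contra tF1 => vH.
apply/(fixing_hyps _ tT reflH); split; first exact: reflections_hyps reflH.
exact: regv (reflections_hyps tT reflH) vH.
Qed.

(** The point is built lexicographically: on roots outside [TF i] the previous point decides, and on
    roots of [TF i] it vanishes and leaves the decision to [v]. *)
Lemma good_position_flag i : (i <= size theta)%N -> exists2 f, f \in F i &
  forall t, t \in T -> t \notin TF i -> 0 < ip (rt t) f.
Proof.
elim: i => [_|i IH lt_i].
  exists 0 => [|t tT /negP[]]; first exact: mem0v.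
  apply/fixingP; split=> // v; rewrite /Fsum big_ord0 memv0 => /eqP ->.
  by rewrite linear0.
have [f fF f_gt0] := IH (ltnW lt_i).
have [v vF v_gt0] := good_position_point lt_i.
(* [1 + M] exceeds every ratio of the values at [v] and [f], so the multiple of [f] dominates. For
   [t] in [TF i] the denominator is 0 and the term is 0 by convention. *)
pose M := \sum_(t in T) `|ip (rt t) v / ip (rt t) f|.
exists ((1 + M) *: f + v) => [|t tT tF1].
  by rewrite memvD // memvZ // Fsum_sub.
rewrite ipDr ipZr; have [tF|tF] := boolP (t \in TF i).
  by rewrite (root_fixing rho_rep c_reg tF fF) mulr0 add0r v_gt0.
have ft := f_gt0 t tT tF.
have le_M : `|ip (rt t) v / ip (rt t) f| <= M.
  by rewrite /M (bigD1 t) //= lerDl sumr_ge0.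
rewrite normrM normfV (gtr0_norm ft) ler_pdivrMr // in le_M.
have := ler_norm (- ip (rt t) v); rewrite normrN mulrDl mul1r; lra.
Qed.

Lemma fixing_Fsum_parabolic i : (i <= size theta)%N ->
  parabolic_reflections W (inversions ip W rho c) (TF i).
Proof.
move=> /good_position_flag[f fF f_gt0].
exact: (fixing_parabolic rho_rep nW c_reg fF f_gt0).
Qed.
End GoodPosition.
End Chamber.

(** * Sign changes of a cos + b sin *)

Section Waves.
Context (R : realType) (a b : R) (a_gt0 : 0 < a).
Implicit Types (x y p : R) (k : nat).

Definition wave x : R := a * cos x + b * sin x.

Lemma wave_shift x k : wave (x + k%:R * pi) = (-1) ^+ k * wave x.
Proof.
rewrite mulr_natl /wave (alternatingn (@cosDpi R)) (alternatingn (@sinDpi R)).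
ring.
Qed.

Lemma wave_shift_lt0 x k : wave x != 0 ->
  (wave (x + k%:R * pi) < 0) = (wave x < 0) (+) odd k.
Proof.
move=> x0; rewrite wave_shift -signr_odd; case: odd; rewrite ?addbT ?addbF.
  by rewrite mulN1r oppr_lt0 lt_def x0 leNgt.
by rewrite mul1r.
Qed.

(** A Sturm-type comparison of the wave with the sine: once the signs of the three sines are known,
    it relates the signs of the wave at [x] and [y]. *)
Lemma wave_wronskian x y :
  wave x * sin y - wave y * sin x = a * sin (y - x).
Proof. rewrite /wave sinB; ring. Qed.

Lemma wavepi : wave pi = - a.
Proof. by rewrite /wave cospi sinpi; ring. Qed.

Lemma wave_same_half x y : 0 <= x -> x <= y -> y < pi ->
  wave x < 0 -> wave y < 0.
Proof.
move=> x_ge0 le_xy lt_y wx.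
have x_gt0 : 0 < x.
  rewrite lt_def x_ge0 andbT; apply: contraTneq wx => ->.
  by rewrite /wave cos0 sin0 mulr0 addr0 mulr1 -leNgt ltW.
have sx : 0 < sin x by rewrite sin_gt0_pi // x_gt0 (le_lt_trans le_xy).
have sy : 0 < sin y by rewrite sin_gt0_pi // lt_y andbT; lra.
have sxy : 0 <= sin (y - x) by apply: sin_ge0_pi; lra.
rewrite ltNge; apply/negP => wy.
have := wave_wronskian x y.
have : wave x * sin y < 0 by rewrite nmulr_rlt0.
have : 0 <= wave y * sin x by rewrite mulr_ge0 // ltW.
have : 0 <= a * sin (y - x) by rewrite mulr_ge0 // ltW.
lra.
Qed.

Lemma wave_next_half x y : 0 <= x -> x < pi -> pi <= y -> y - x <= pi ->
  0 < wave x -> wave y != 0 -> wave y < 0.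
Proof.
move=> x_ge0 lt_x le_y le_xy wx wy.
have [x0|x0] := eqVneq x 0.
  have -> : y = pi by lra.
  by rewrite wavepi oppr_lt0.
have sx : 0 < sin x by rewrite sin_gt0_pi // lt_def x0 x_ge0.
have sy : sin y <= 0.
  have -> : y = (y - pi) + pi by ring.
  by rewrite sinDpi oppr_le0 sin_ge0_pi //; lra.
have sxy : 0 <= sin (y - x) by apply: sin_ge0_pi; lra.
rewrite lt_neqAle wy leNgt /=; apply/negP => wy_gt0.
have := wave_wronskian x y.
have : wave x * sin y <= 0 by rewrite mulr_ge0_le0 // ltW.
have : 0 < wave y * sin x by rewrite mulr_gt0.
have : 0 <= a * sin (y - x) by rewrite mulr_ge0 // ltW.
lra.
Qed.

Lemma wave_same_turn x y k :
  k%:R * pi <= x -> x <= y -> y < k.+1%:R * pi ->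
  wave x != 0 -> wave y != 0 ->
  (wave x < 0) != odd k -> (wave y < 0) = (wave x < 0).
Proof.
rewrite -natr1 => le_x le_xy lt_y.
have -> : x = (x - k%:R * pi) + k%:R * pi by ring.
have -> : y = (y - k%:R * pi) + k%:R * pi by ring.
move=> x0 y0; move: (x0) (y0); rewrite !wave_shift !mulf_eq0 !negb_or.
move=> /andP[_ x1] /andP[_ y1]; rewrite -!wave_shift !wave_shift_lt0 //.
move=> H; congr (_ (+) _); have lt_wx : wave (x - k%:R * pi) < 0.
  by move: H; case: (_ < 0); case: odd.
rewrite lt_wx; apply: wave_same_half lt_wx; lra.
Qed.

Lemma wave_next_turn x y k :
  k%:R * pi <= x -> x < k.+1%:R * pi -> k.+1%:R * pi <= y -> y - x <= pi ->
  wave x != 0 -> wave y != 0 ->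
  (wave x < 0) = odd k -> (wave y < 0) = ~~ odd k.
Proof.
rewrite -natr1 => le_x lt_x le_y le_xy.
have -> : x = (x - k%:R * pi) + k%:R * pi by ring.
have -> : y = (y - k%:R * pi) + k%:R * pi by ring.
move=> x0 y0; move: (x0) (y0); rewrite !wave_shift !mulf_eq0 !negb_or.
move=> /andP[_ x1] /andP[_ y1]; rewrite -!wave_shift !wave_shift_lt0 //.
move=> H; have ge_wx : 0 < wave (x - k%:R * pi).
  by rewrite lt_def x1 leNgt; move: H; case: (_ < 0); case: odd.
have -> : wave (y - k%:R * pi) < 0; last by case: odd.
by apply: wave_next_half ge_wx _; rewrite // ?lra; lra.
Qed.

(** As [p / pi] is at most 1, one step completes at most one half turn. *)
Lemma truncn_rotation_step p j : 0 <= p <= pi ->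
  let K j := Num.truncn (j%:R * p / pi) in K j.+1 = K j \/ K j.+1 = (K j).+1.
Proof.
move=> /andP[p0 ppi] K; have pi0 := @pi_gt0 R.
have q_ge0 i : 0 <= i%:R * p / pi by rewrite divr_ge0 ?mulr_ge0 // ltW.
have /andP[lo hi] := truncn_itv (q_ge0 j).
have E : j.+1%:R * p / pi = j%:R * p / pi + p / pi.
  by rewrite -natr1 mulrDl mul1r mulrDl.
have p1 : p / pi <= 1 by rewrite ler_pdivrMr // mul1r.
have p2 : 0 <= p / pi by rewrite divr_ge0 // ltW.
have [lt|ge] := ltP (j.+1%:R * p / pi) (K j).+1%:R.
  by left; apply: truncn_def; rewrite lt andbT E (le_trans lo) // lerDl.
right; apply: truncn_def; rewrite ge /= E -natr1; move: hi; rewrite -/(K j); lra.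
Qed.

Lemma truncn_rotation_itv p j (k := Num.truncn (j%:R * p / pi)) :
  0 <= p -> k%:R * pi <= j%:R * p < k.+1%:R * pi.
Proof.
move=> p0; have pi0 := @pi_gt0 R.
have /truncn_itv/andP[lo hi] : 0 <= j%:R * p / pi.
  by rewrite divr_ge0 ?mulr_ge0 // ltW.
by rewrite -ler_pdivlMr // lo -ltr_pdivrMr.
Qed.
End Waves.

(** * Eigenspaces *)

Section Eigenspaces.
Context (R : realType) (V : normedVectType R) (ip : {dot V for idfun}).
Context (gT : finGroupType) (rho : gT -> 'End(V)).
Context (rho_rep : orth_rep ip rho) (w : gT).
Implicit Types (u v a : V) (p : R) (theta : seq R).

Lemma Vthetaf_eq p v : (v \in Vtheta rho w p) =
  (rho w v + rho w^-1%g v == (2 * cos p) *: v).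
Proof.
by rewrite memv_ker !add_lfunE opp_lfunE scale_lfunE id_lfunE subr_eq0.
Qed.

Lemma Vtheta_stable p v :
  v \in Vtheta rho w p -> rho w v \in Vtheta rho w p.
Proof.
rewrite !Vthetaf_eq => /eqP E.
by rewrite (rhoK rho_rep) -{2}(rhoVK rho_rep w v) -linearD E linearZ.
Qed.

Lemma Fsum_stable theta i v :
  v \in Fsum rho w theta i -> rho w v \in Fsum rho w theta i.
Proof.
elim: i v => [|i IH] v.
  by rewrite /Fsum big_ord0 memv0 => /eqP ->; rewrite linear0 mem0v.
rewrite /Fsum big_ord_recr /= => /memv_addP[f fF [v' v'V ->]].
by rewrite linearD memv_add //; [exact: IH | exact: Vtheta_stable].
Qed.

Lemma Fsum_stableX theta i j v :
  v \in Fsum rho w theta i -> rho (w ^+ j)%g v \in Fsum rho w theta i.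
Proof.
move=> vF; elim: j => [|j IH]; first by rewrite (rho1 rho_rep).
by rewrite expgS (rhoM rho_rep) Fsum_stable.
Qed.

(** The eigenspace condition prescribes only [rho w + rho w^-1]; since [rho w] is an isometry and
    [cos p] squares to 1, the squared norm of [rho w v - cos p v] vanishes. *)
Lemma Vtheta_degenerate p v : v \in Vtheta rho w p -> sin p = 0 ->
  rho w v = cos p *: v.
Proof.
rewrite Vthetaf_eq => /eqP E sp; apply/eqP; rewrite -subr_eq0; apply/eqP.
apply: (ip_eq0 (ip := ip)).
have := congr1 (ip v) E; rewrite ipDr ipZr (ip_rhoV rho_rep w^-1%g) invgK.
rewrite (ipC ip (rho w v) v) => E1.
have EY : ip v (rho w v) = cos p * ip v v by lra.
have CX : cos p * (cos p * ip v v) = ip v v.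
  by rewrite mulrA -expr2; have := cos2Dsin2 p;
    rewrite sp expr0n addr0 => ->; rewrite mul1r.
rewrite !(ipBl, ipBr, ipZl, ipZr) (ip_rho rho_rep) (ipC ip (rho w v) v) EY.
by rewrite !CX; lra.
Qed.

(** The sequence satisfies [x_(j+2) = 2 cos p x_(j+1) - x_j], which the waves solve. If [sin p = 0],
    then [rho w] acts on [v] as the sign [cos p] instead. *)
Lemma Vtheta_wave p v a : v \in Vtheta rho w p ->
  exists b, forall j, ip a (rho (w ^+ j)%g v) = wave (ip a v) b (j%:R * p).
Proof.
move=> vV; have [sp|sp] := eqVneq (sin p) 0.
  exists 0 => j; rewrite /wave mul0r addr0.
  have -> : rho (w ^+ j)%g v = cos p ^+ j *: v.
    elim: j => [|j IH]; first by rewrite (rho1 rho_rep) scale1r.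
    by rewrite expgS (rhoM rho_rep) IH linearZ /= (Vtheta_degenerate vV sp)
      scalerA -exprSr.
  rewrite ipZr mulrC; congr (_ * _).
  elim: j => [|j IH]; first by rewrite mul0r cos0.
  by rewrite -natr1 mulrDl mul1r cosD sp mulr0 subr0 exprSr IH.
(* This [b] makes the wave agree with the sequence at [j = 1]. *)
pose b := (ip a (rho w v) - ip a v * cos p) / sin p; exists b => j.
suff [] : ip a (rho (w ^+ j)%g v) = wave (ip a v) b (j%:R * p) /\
  ip a (rho (w ^+ j.+1)%g v) = wave (ip a v) b (j.+1%:R * p) by [].
elim: j => [|j [IH1 IH2]].
  rewrite (rho1 rho_rep) mul0r mul1r /wave cos0 sin0 /b; split; first by ring.
  by field.
split=> //; move: vV; rewrite Vthetaf_eq => /eqP/(congr1 (rho (w ^+ j.+1)%g)).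
rewrite linearD linearZ /= -!(rhoM rho_rep) -expgSr [in X in _ + X]expgSr mulgK.
move=> /(congr1 (ip a)); rewrite ipDr ipZr IH1 IH2 => E.
have -> : ip a (rho (w ^+ j.+2)%g v) = 2 * cos p * wave (ip a v) b (j.+1%:R * p)
   - wave (ip a v) b (j%:R * p) by rewrite -E addrK.
rewrite /wave -!natr1 !mulrDl !mul1r !(cosD, sinD).
have := cos2Dsin2 p; set C := cos p; set D := sin p => CD.
(* Multiplying the subtracted terms by [C ^+ 2 + D ^+ 2] makes the claim a polynomial identity. *)
rewrite -[X in _ - (X * _ + _)]mulr1 -[X in _ - (_ + X * _)]mulr1 -CD.
ring.
Qed.
End Eigenspaces.

(** * The irredundant sequence *)

Lemma monoid_power_step (M : monoidType) (a b p x : M) m n : (m <= n)%N ->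
  (a * x ^+ m = b * p)%g -> (a * x ^+ n = b * (p * x ^+ (n - m)))%g.
Proof. by move=> le_mn E; rewrite mulgA -E -mulgA -expgnDr subnKC. Qed.

Section Main.
Context (R : realType) (gT : finGroupType).
Context (W : {group gT}) (S : {set gT}) (delta : gT).
Context (coxWS : coxeter_system W S) (nS : delta \in 'N(S)%g).
Context (sdW : (W ><| <[delta]> = [set: gT])%g).
Context (V : normedVectType R) (ip : {dot V for idfun}).
Context (norm_ip : inner_norm ip) (rho : gT -> 'End(V)).
Context (rho_rep : orth_rep ip rho).
Context (rho_refl : forall s, s \in S -> exists H, orth_refl ip H (rho s)).
Context (C : set V) (C_fund : fundamental_chamber ip W rho S C).
Context (C_delta : (rho delta @` C)%classic = C).
Context (w : gT) (theta : seq R).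
Context (theta_bound : {in theta, forall p, 0 <= p <= pi}).
Context (C_good : good_position ip W rho w theta C).
Context (c : V) (c_reg : forall t, t \in reflections ip W rho -> rho t c != c).
Context (EC : C = connected_component (hyps_compl (hyps ip W rho)) c).
Local Notation lift := (tbraid_lift nS W).
Local Notation N := (inversions ip W rho c).
Local Notation F := (Fsum rho w theta).
Local Notation TF i := (fixing ip W rho (F i)).
Local Notation omega i := (longest_elt S <<TF i>>%g).
Local Notation rt := (root rho c).
Local Open Scope group_scope.

Let nW : [set: gT] \subset 'N(W).
Proof. by have [/andP[]] := sdprod_context sdW. Qed.

Let sysN : inversion_system W S N.
Proof. exact: (inversions_system coxWS norm_ip rho_rep nW rho_refl C_fund c_reg EC). Qed.

Let Ndelta : N delta = finset.set0.
Proof. exact: (inversions_twist norm_ip rho_rep C_fund c_reg EC C_delta). Qed.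

Let par i : (i <= size theta)%N -> parabolic_reflections W N (TF i).
Proof. exact: (fixing_Fsum_parabolic norm_ip rho_rep nW c_reg EC C_good). Qed.

(** Minimal length in the coset of [w] is expressed by the absence of inversions in [TF i]. *)
Definition minimal_rep i (x : gT) := x * w^-1 \in <<TF i>> /\
  forall t, t \in TF i -> t \in N x = false.

Lemma minimal_rep_exists i : (i <= size theta)%N -> exists x, minimal_rep i x.
Proof.
move=> /par parA; have [u uA ux] := min_coset_rep sdW sysN Ndelta w parA.
by exists (u * w); split; rewrite ?mulgK.
Qed.

Lemma minimal_rep_act i x v : minimal_rep i x -> v \in F i ->
  rho x v = rho w v.
Proof.
move=> [xA _] vF; rewrite -[x in LHS](mulgKV w) (rhoM rho_rep).
by rewrite (gen_fixing rho_rep xA) // (Fsum_stable rho_rep).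
Qed.

Lemma minimal_rep_actX i x j v : minimal_rep i x -> v \in F i ->
  rho (x ^+ j) v = rho (w ^+ j) v.
Proof.
move=> repx vF; elim: j => [|j IH] //.
by rewrite !expgS !(rhoM rho_rep) IH (minimal_rep_act repx) ?(Fsum_stableX rho_rep).
Qed.

Lemma minimal_rep_norm i x : minimal_rep i x -> x \in 'N(TF i).
Proof.
move=> repx; apply: (fixing_norm rho_rep nW) => v vF.
by rewrite (minimal_rep_act repx) ?(Fsum_stable rho_rep).
Qed.

Lemma lift_rep_step i n m x y : (i < size theta)%N ->
  (n%:R * theta`_i = m%:R * pi)%R -> minimal_rep i x -> minimal_rep i.+1 y ->
  lift y ^+ n * lift (omega i.+1) ^+ m = lift x ^+ n * lift (omega i) ^+ m.
Proof.
move=> lt_i En repx repy; have [v vF v_gt0] :=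
  good_position_point norm_ip rho_rep c_reg EC C_good lt_i.
have bound : (0 <= theta`_i <= pi)%R by apply: theta_bound; rewrite mem_nth.
have /andP[th_ge0 _] := bound.
have sBA : TF i.+1 \subset TF i by apply: fixing_Fsum_sub.
have nAy : y \in 'N(TF i).
  rewrite -(mulgKV w y) groupM //.
    apply: (fintype.subsetP (par_norm (par (ltnW lt_i)))).
    exact: (fintype.subsetP (genS sBA)) repy.1.
  by apply: (fixing_norm rho_rep nW) => u; apply: (Fsum_stable rho_rep).
have nBy := minimal_rep_norm repy.
(* Entries of [theta] are numbered from 0, so entry [i] is the angle added between [F i] and
   [F i.+1]. Roots of [TF i] vanish on [f], and only [v'] will contribute. *)
have [f fF [v' v'V Ev]] : exists2 f, f \in F i &
    exists2 v', v' \in Vtheta rho w theta`_i & v = (f + v')%R.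
  by move: vF; rewrite /Fsum big_ord_recr /= => /memv_addP[f fF [v' ? ?]];
    exists f => //; exists v'.
have key t : t \in TF i -> t \notin TF i.+1 -> exists a b, [/\ (0 < a)%R,
    forall j, wave a b (j%:R * theta`_i) != 0%R &
    forall j, (t \in N (y ^+ j)) = (wave a b (j%:R * theta`_i) < 0)%R].
  move=> tA tB; have [b Eb] := Vtheta_wave rho_rep (rt t) v'V.
  exists (ip (rt t) v'), b.
  have ipE j : ip (rt t) (rho (y ^+ j) v) =
               wave (ip (rt t) v') b (j%:R * theta`_i).
    rewrite (minimal_rep_actX _ repy vF) Ev linearD ipDr /= Eb.
    have f0 := root_fixing rho_rep c_reg tA (Fsum_stableX rho_rep j fF).
    by rewrite f0 add0r.
  have tT : t \in reflections ip W rho by have /fixingP[] := tA.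
  have sgn j := inversions_sign rho_rep nW c_reg (x := y ^+ j) (v := v) tT.
  (* [y] normalizes [TF i] and [TF i.+1], so [v] is positive on the conjugates of [t] too and serves
     as test vector for every [y ^+ j]. *)
  have pos j : (0 < ip (rt (t ^ (y ^+ j))) v)%R.
    by apply: v_gt0; rewrite memJ_norm ?groupX.
  split=> [|j|j]; [|by rewrite -ipE; case: (sgn j (pos j))
    |by rewrite -ipE; case: (sgn j (pos j))].
  have := v_gt0 _ tA tB; rewrite Ev ipDr.
  by rewrite (root_fixing rho_rep c_reg tA fF) add0r.
(* The number of half turns completed at time [j]. *)
pose K j := Num.truncn (j%:R * theta`_i / pi)%R.
have Kn : K n = m by rewrite /K En mulfK ?lt0r_neq0 ?pi_gt0 // natrK.
have uA : y * x^-1 \in <<TF i>>.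
  have -> : y * x^-1 = (y * w^-1) * (x * w^-1)^-1.
    by rewrite invMg invgK mulgA mulgKV.
  rewrite groupM ?groupV ?repx.1 //.
  exact: (fintype.subsetP (genS sBA)) repy.1.
have := lift_rotation (x := x) (u := y * x^-1) (K := K) (n := n)
  nS sdW sysN Ndelta sBA (par (ltnW lt_i)) (par lt_i).
rewrite mulgKV Kn; apply => //.
- exact: minimal_rep_norm.
- exact: repx.2.
- exact: repy.2.
- by rewrite /K !mul0r truncn0.
- move=> j _; have itv := truncn_rotation_itv _ th_ge0.
  have /andP[lo1 hi1] := itv j; have /andP[lo2 hi2] := itv j.+1.
  have step_le : (j.+1%:R * theta`_i - j%:R * theta`_i <= pi)%R.
    by case/andP: bound => _; rewrite -natr1; lra.
  case: (truncn_rotation_step j bound); rewrite -/(K j) -/(K j.+1) => EK.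
    left; split=> // t tA tB; have [a [b [a0 nz sgn]]] := key t tA tB.
    rewrite !sgn; apply: wave_same_turn => //.
    + by rewrite -natr1; lra.
    + by rewrite -EK.
  right; split=> // t tA tB; have [a [b [a0 nz sgn]]] := key t tA tB.
  rewrite !sgn; apply: wave_next_turn => //.
  by rewrite -EK.
(* At time [n] the angle is [m pi], where the wave equals [(-1)^m a] with [a > 0]. *)
- move=> t tA tB; have [a [b [a0 nz sgn]]] := key t tA tB.
  rewrite sgn En -[(m%:R * pi)%R]add0r wave_shift_lt0 // /wave cos0 sin0 mulr0 addr0 mulr1.
    by rewrite ltNge (ltW a0).
  by rewrite gt_eqF.
Qed.

Lemma WsubE i : Wsub ip W rho w theta i = <<TF i>>.
Proof. exact: (refl_subgroupE). Qed.

(** The fixing reflections are recovered from the group they generate: [t] is an inversion of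
    itself, and inversions of elements of [<<TF b>>] lie in [TF b]. *)
Lemma fixing_Wsub_sub a b : (a <= size theta)%N -> (b <= size theta)%N ->
  Wsub ip W rho w theta a = Wsub ip W rho w theta b -> TF a \subset TF b.
Proof.
move=> le_a le_b; rewrite !WsubE => Eab; apply/fintype.subsetP => t ta.
have tb : t \in <<TF b>> by rewrite -Eab mem_gen.
by apply: (fintype.subsetP (par_inv (par le_b) tb)); exact: par_self (par le_a) _ ta.
Qed.

Lemma lift_twistX a n : a \in <[delta]> -> lift a ^+ n = lift (a ^+ n).
Proof.
move=> aD; elim: n => [|n IH]; first by rewrite (lift1 nS sdW sysN).
rewrite !expgS IH (lift_mul nS sdW sysN Ndelta) // => t.
by rewrite (inv_twist sysN Ndelta aD) finset.in_set0.
Qed.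

(** [F 0] is zero, so every reflection fixes it; [x] then has no inversions and its factor in [W] is
    trivial. *)
Lemma minimal_rep0 x : minimal_rep 0 x -> x \in <[delta]>.
Proof.
move=> [_ xT]; have [a [u [aD uW Ex]]] := twist_factor sdW x.
suff u1 : u = 1 by rewrite Ex u1 mulg1.
apply: (inv_inj sysN); first by rewrite mulg1 groupV.
apply/setP => t; rewrite (inv1 sysN) finset.in_set0.
apply/negP => tu; have tT : t \in reflections ip W rho.
  by move: tu; rewrite mem_inversions => /andP[].
have := xT (t ^ a^-1); rewrite Ex (inv_twist_mul sysN Ndelta) // conjgKV tu.
move=> /(_ _)/negP; apply=> //; apply/fixingP; split.
  by rewrite mem_reflectionsJ.
by move=> v; rewrite /Fsum big_ord0 memv0 => /eqP ->; rewrite linear0.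
Qed.

Context (theta_sorted : sorted <%R theta).
Context (k : nat) (i : nat -> nat).
Context (irr : irredundant_indices (Wsub ip W rho w theta) (size theta) k i).

Lemma index_le j : (j <= k)%N -> (i j <= size theta)%N.
Proof.
have [_ incr le_k _ _] := irr => le_j; apply: leq_trans le_k.
have [e] := ubnP (k - j); elim: e j le_j => // e IH j le_j lt_e.
have [->//|neq] := eqVneq j k.
have lt_j : (j < k)%N by rewrite ltn_neqAle neq.
apply: leq_trans (ltnW (incr j lt_j)) (IH _ lt_j _).
by rewrite -ltnS subnSK.
Qed.

Lemma vartheta_mono j : (j < k)%N ->
  (vartheta theta i j <= vartheta theta i j.+1)%R.
Proof.
have [i0 incr _ _ _] := irr; move=> lt_j.
have le1 := index_le lt_j; have lt_i := incr j lt_j.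
have in_theta : ((i j.+1).-1 < size theta)%N.
  by rewrite prednK // (leq_ltn_trans _ lt_i).
case: j => [|j] in lt_j le1 lt_i in_theta *.
  by have /andP[] := theta_bound (mem_nth 0%R in_theta).
have ij : (0 < i j.+1)%N by rewrite (leq_ltn_trans _ (incr j (ltnW lt_j))).
rewrite /= ltW // (sorted_ltn_nth lt_trans) // ?inE //.
  by rewrite (leq_ltn_trans _ in_theta) // -!subn1 leq_sub2r // ltnW.
by rewrite -ltnS !prednK // (leq_ltn_trans _ lt_i).
Qed.

Local Notation wmax j := (longest_elt S (Wsub ip W rho w theta (i j))).

Lemma lift_power n :
  (forall j, (1 <= j <= k)%N ->
     (n%:R * vartheta theta i j / pi)%R \is a Num.nat) ->
  let m j := Num.truncn (n%:R * vartheta theta i j / pi)%R in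
  exists sigma : [subg <[delta]> ],
    lift w ^+ n = tbraid_delta nS sigma *
      \prod_(0 <= j < k)
        lift (wmax j) ^+ (m j.+1 - m j).
Proof.
move=> n_int m; have [i0 incr _ jumps last1] := irr.
have m0 : m 0%N = 0%N by rewrite /m /= mulr0 mul0r truncn0.
have mE j : (1 <= j <= k)%N ->
    (n%:R * vartheta theta i j = (m j)%:R * pi)%R.
  move=> /n_int; rewrite natrEtruncn -/(m j) => /eqP ->.
  by rewrite divfK // lt0r_neq0 // pi_gt0.
have le_m j : (j < k)%N -> (m j <= m j.+1)%N.
  move=> lt_j; apply: le_truncn; rewrite ler_pM2r ?invr_gt0 ?pi_gt0 //.
  by rewrite ler_wpM2l // vartheta_mono.
clearbody m.
have main j : (j <= k)%N -> exists (sigma : [subg <[delta]> ]) x,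
    minimal_rep (i j) x /\ lift x ^+ n * lift (wmax j) ^+ m j =
      tbraid_delta nS sigma *
      \prod_(0 <= l < j) lift (wmax l) ^+ (m l.+1 - m l).
  elim: j => [_|j IH lt_j].
    have [x repx] := minimal_rep_exists (leq0n _).
    have xD := minimal_rep0 repx.
    exists (subg <[delta]> (x ^+ n)), x; rewrite i0; split=> //.
    rewrite big_nil mulg1 m0 mulg1 lift_twistX //.
    by rewrite (lift_twist nS sdW sysN) // groupX.
  have [sigma [x [repx Ex]]] := IH (ltnW lt_j).
  have [y repy] := minimal_rep_exists (index_le lt_j).
  have lt_i := incr j lt_j; have [const _] := jumps j lt_j.
  have ip_gt0 : (0 < i j.+1)%N by rewrite (leq_ltn_trans _ lt_i).
  have Ei : (i j.+1).-1.+1 = i j.+1 by rewrite prednK.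
  have lt_p : ((i j.+1).-1 < size theta)%N by rewrite Ei index_le.
  have EW : Wsub ip W rho w theta (i j.+1).-1 = Wsub ip W rho w theta (i j).
    by apply: const; rewrite -ltnS Ei lt_i leqnn.
  (* The group is constant from [i j] up to the index before [i j.+1], hence so are its reflections,
     and [x] is still a minimal representative there. *)
  have ETF : TF (i j.+1).-1 = TF (i j).
    apply/eqP; rewrite finset.eqEsubset !fixing_Wsub_sub //.
    - exact: index_le (ltnW lt_j).
    - exact: ltnW.
    - exact: ltnW.
    - exact: index_le (ltnW lt_j).
  exists sigma, y; split=> //.
  have repx' : minimal_rep (i j.+1).-1 x by rewrite /minimal_rep ETF.
  have repy' : minimal_rep (i j.+1).-1.+1 y by rewrite Ei.
  have := lift_rep_step lt_p (mE j.+1 lt_j) repx' repy'.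
  rewrite Ei -!WsubE EW => ->.
  rewrite big_nat_recr //=.
  (* Of the [m j.+1] factors, [m j] are absorbed by the previous equation and the others form the
     new factor of the product. *)
  exact: (monoid_power_step (le_m j lt_j) Ex).
(* At [j = k] the parabolic subgroup is trivial, so the representative is [w] itself and the
   leftover longest element is 1. *)
have [sigma [x [[xw _] E]]] := main k (leqnn k); exists sigma.
have TF1 : <<TF (i k)>> = 1 by rewrite -WsubE.
have Ew : x = w by move: xw; rewrite TF1 => /set1gP/(canRL (mulgKV w)); rewrite mul1g.
have Eo : wmax k = 1.
  by rewrite WsubE; have := longest_mem sdW sysN Ndelta (par (index_le (leqnn k))); rewrite TF1 => /set1gP.
by move: E; rewrite Ew Eo (lift1 nS sdW sysN) expg1n mulg1.
Qed.
End Main.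

(** * Integrality of the exponents *)

Section Exponents.
Context (R : realType) (theta : seq R) (i : nat -> nat) (k : nat).
Context (theta_ge0 : {in theta, forall p, 0 <= p}).

Lemma vartheta_ge0 j : 0 <= vartheta theta i j.
Proof.
case: j => [|j] //=; have [lt|ge] := ltnP (i j.+1).-1 (size theta).
  by rewrite theta_ge0 ?mem_nth.
by rewrite nth_default.
Qed.

Lemma nat_ratio n e j (z : R) : z \is a Num.int ->
  n%:R * vartheta theta i j / pi = e%:R * z ->
  n%:R * vartheta theta i j / pi \is a Num.nat.
Proof.
move=> z_int E; rewrite natrEint divr_ge0 ?mulr_ge0 ?vartheta_ge0 ?pi_ge0 //.
by rewrite andbT E rpredM // rpred_nat.
Qed.

(** Both terms of the difference are natural numbers, so truncation may be applied to each
    separately. *)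
Lemma twist_exponentE (d n : nat) (b : R) j :
  (forall x : R, d%:R * x / b = n%:R * x / pi) ->
  n%:R * vartheta theta i j / pi \is a Num.nat ->
  n%:R * vartheta theta i j.+1 / pi \is a Num.nat ->
  vartheta theta i j <= vartheta theta i j.+1 ->
  twist_exponent theta i d b j =
    (Num.truncn (n%:R * vartheta theta i j.+1 / pi) -
     Num.truncn (n%:R * vartheta theta i j / pi))%N.
Proof.
move=> dn nat1 nat2 le; rewrite /twist_exponent dn mulrBr mulrBl.
rewrite -[X in Num.truncn (X - _)](truncnK nat2).
rewrite -[X in Num.truncn (_ - X)](truncnK nat1) -natrB ?natrK //.
by apply: le_truncn; rewrite ler_pM2r ?invr_gt0 ?pi_gt0 // ler_wpM2l.
Qed.
End Exponents.

Theorem theorem5p2 (R : realType) (gT : finGroupType)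
    (W : {group gT}) (S : {set gT}) (delta : gT)
    (coxWS : coxeter_system W S)
    (nSdelta : delta \in 'N(S)%g)
    (semidirect : (W ><| <[delta]> = [set: gT])%g)
    (faithful_delta : ('C_(<[delta]>)(W) = 1)%g)
    (V : normedVectType R) (ip : {dot V for idfun})
    (norm_ip : inner_norm ip)
    (rho : gT -> 'End(V))
    (rho_rep : orth_rep ip rho)
    (rho_refl : forall s, s \in S -> exists H, orth_refl ip H (rho s))
    (C : set V)
    (C_fund : fundamental_chamber ip W rho S C)
    (C_delta : (rho delta @` C)%classic = C)
    (w : gT) (theta : seq R)
    (theta_adm : admissible ip W rho w theta)
    (C_good : good_position ip W rho w theta C)
    (k : nat) (i : nat -> nat)
    (irr : irredundant_indices (Wsub ip W rho w theta) (size theta) k i)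
    (d : nat)
    (d_int : forall j, (1 <= j <= k)%N ->
       d%:R * vartheta theta i j / (2 * pi) \is a Num.int) :
  let wmax j := longest_elt S (Wsub ip W rho w theta (i j)) in
  let lift := tbraid_lift nSdelta W in
  (exists sigma : [subg <[delta]> ],
     (lift w ^+ d = tbraid_delta nSdelta sigma *
        \prod_(0 <= j < k) lift (wmax j) ^+ twist_exponent theta i d pi j)%g) /\
  (~~ odd d ->
   exists sigma' : [subg <[delta]> ],
     (lift w ^+ d./2 = tbraid_delta nSdelta sigma' *
        \prod_(0 <= j < k)
           lift (wmax j) ^+ twist_exponent theta i d (2 * pi) j)%g).
Proof.
move=> wmax lift.
have nW : ([set: gT] \subset 'N(W))%g.
  by have [/andP[]] := sdprod_context semidirect.
have [c c_reg EC] := chamber_center C_fund.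
have [theta_sorted theta_Gamma _] := theta_adm.
have theta_bound : {in theta, forall p, 0 <= p <= pi}.
  by move=> p /theta_Gamma[].
have theta_ge0 : {in theta, forall p, 0 <= p}.
  by move=> p /theta_bound/andP[].
have pi_neq0 : pi != 0 :> R by rewrite lt0r_neq0 // pi_gt0.
(* The two formulas are the cases [n = d], [b = pi] and [n = d/2], [b = 2 pi]. *)
have power n b : (forall x : R, d%:R * x / b = n%:R * x / pi) ->
    (forall j, (1 <= j <= k)%N ->
       n%:R * vartheta theta i j / pi \is a Num.nat) ->
    exists sigma : [subg <[delta]> ],
      (lift w ^+ n = tbraid_delta nSdelta sigma *
         \prod_(0 <= j < k) lift (wmax j) ^+ twist_exponent theta i d b j)%g.
  move=> dn n_nat.
  have [sigma E] := lift_power coxWS nSdelta semidirect norm_ip rho_rep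
    rho_refl C_fund C_delta theta_bound C_good c_reg EC theta_sorted irr n_nat.
  exists sigma; rewrite [LHS]E; congr (_ * _)%g.
  apply: eq_big_nat => j /andP[_ lt_j]; congr (_ ^+ _)%g.
  apply: esym; apply: twist_exponentE => //; last first.
  - exact: (vartheta_mono theta_bound theta_sorted irr lt_j).
  - exact: (n_nat j.+1).
  by case: j lt_j => [|j] lt_j; [rewrite /= mulr0 mul0r rpred0|exact/n_nat/ltnW].
have half (p x y : R) : p != 0 -> x * y / p = 2%:R * (x * y / (2 * p)).
  by move=> p0; field.
have double (p x y : R) : p != 0 -> (x * 2%:R) * y / (2 * p) = x * y / p.
  by move=> p0; field.
split=> [|/even_halfK d_even].
  apply: power => // j /d_int/(nat_ratio (n := d) (e := 2) theta_ge0); apply.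
  exact: half.
have dE : d%:R = d./2%:R * 2%:R :> R by rewrite -natrM muln2 d_even.
apply: power => [x|j /d_int/(nat_ratio (n := d./2) (e := 1) theta_ge0)].
  by rewrite dE double.
by apply; rewrite dE double // mul1r.
Qed.
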